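(* Let $n\geq -1$ be an integer, let $E$ be a Banach space and let $\mathscr{S}$ be a uniformly equi-$LC^n$ family of subsets of $E$. Then there exists a function $\gamma:(0,+\infty)\to(0,+\infty)$ with the following property. If $X$ is a paracompact space with $\dim(X)\leq n+1$, $\Phi:X\to\mathscr{S}$ is lower semi-continuous, $\varepsilon>0$, and $g:X\to E$ is a continuous $\gamma(\varepsilon)$-selection for $\Phi$, then there is a continuous map $f:X\to E$ such that $f(x)\in\overline{\Phi(x)}$ and $\|f(x)-g(x)\|<\varepsilon$ for every $x\in X$.
   Context: All spaces are Hausdorff topological spaces; $\dim$ is covering dimension. A mapping $\Phi$ from $X$ to the nonempty subsets of a space $E$ is lower semi-continuous if $\{x\in X:\Phi(x)\cap U\neq\emptyset\}$ is open in $X$ for every open $U\subset E$. A map $g:X\to E$ is an $\varepsilon$-selection for $\Phi$ if for every $x\in X$ there is $y\in\Phi(x)$ with $\|g(x)-y\|<\varepsilon$. A family $\mathscr{S}$ of nonempty subsets of a metric space is uniformly equi-$LC^n$ if for every $\varepsilon>0$ there exists $\delta(\varepsilon)>0$ such that, for every $S\in\mathscr{S}$ and every $0\le k\leq n$, every continuous map of the $k$-sphere into $S$ whose image has diameter $<\delta(\varepsilon)$ can be extended to a continuous map of the $(k+1)$-ball into a subset of $S$ of diameter $<\varepsilon$. By convention, uniformly equi-$LC^{-1}$ means only that the family consists of nonempty sets. *)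

(* Defs.v *)
From HB Require Import structures.
From mathcomp Require Import all_boot all_order all_algebra finmap.
From mathcomp Require Import all_classical all_reals all_analysis.

Set Implicit Arguments.
Unset Strict Implicit.
Unset Printing Implicit Defensive.

Import Order.TTheory GRing.Theory Num.Theory.
Import numFieldNormedType.Exports.

Local Open Scope classical_set_scope.
Local Open Scope ring_scope.

Section Covers.
Variable X : topologicalType.

Definition open_cover (U : set (set X)) : Prop :=
  U `<=` open /\ \bigcup_(A in U) A = [set: X].

Definition refines (V U : set (set X)) : Prop :=
  forall B, V B -> exists2 A, U A & B `<=` A.

Definition locally_finite (V : set (set X)) : Prop :=
  forall x : X, exists2 N, nbhs x N &
    finite_set [set B | V B /\ B `&` N !=set0].

Definition paracompact_space : Prop :=
  hausdorff_space X /\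
  forall U, open_cover U ->
    exists V, [/\ open_cover V, refines V U & locally_finite V].

(* A family has order at most d when no point lies in more than d + 1 of its
   members (Engelking's normalization). *)
Definition order_le (V : set (set X)) (d : int) : Prop :=
  forall (x : X) (s : {fset set X}),
    (forall B, B \in s -> V B /\ B x) -> (#|` s|)%:Z <= d + 1.

(* The relation dim X <= d for the Cech-Lebesgue covering dimension, defined by
   finite open covers; dim X = -1 exactly when X is empty. *)
Definition covering_dim_le (d : int) : Prop :=
  -1 <= d /\
  forall U, finite_set U -> open_cover U ->
    exists V, [/\ finite_set V, open_cover V, refines V U & order_le V d].

End Covers.

Section EquiLC.
Variable R : realType.

Definition euclidean_sphere (k : nat) : set 'rV[R]_k.+1 :=
  [set v | \sum_i v ord0 i ^+ 2 = 1].

Definition euclidean_ball (k : nat) : set 'rV[R]_k.+1 :=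
  [set v | \sum_i v ord0 i ^+ 2 <= 1].

Variable E : normedModType R.

(* Equal to -oo, rather than 0, on the empty set. *)
Definition diameter (A : set E) : \bar R :=
  ereal_sup [set (`|p.1 - p.2|)%:E | p in A `*` A].

Definition uniformly_equi_LC (n : int) (S : set (set E)) : Prop :=
  (forall A, S A -> A !=set0) /\
  forall eps : R, 0 < eps -> exists2 delta : R, 0 < delta &
    forall A, S A -> forall k : nat, k%:Z <= n ->
    forall u : 'rV[R]_k.+1 -> E,
      {within @euclidean_sphere k, continuous u} ->
      u @` @euclidean_sphere k `<=` A ->
      (diameter (u @` @euclidean_sphere k) < delta%:E)%E ->
      exists v : 'rV[R]_k.+1 -> E,
        [/\ {within @euclidean_ball k, continuous v},
            {in @euclidean_sphere k, v =1 u},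
            v @` @euclidean_ball k `<=` A &
            (diameter (v @` @euclidean_ball k) < eps%:E)%E].

End EquiLC.

Section SetValued.
Variables (R : realType) (X : topologicalType) (E : normedModType R).

(* The values are not required to be nonempty here. *)
Definition lower_semi_continuous (Phi : X -> set E) : Prop :=
  forall U : set E, open U -> open [set x | Phi x `&` U !=set0].

Definition approx_selection (Phi : X -> set E) (eps : R) (g : X -> E) : Prop :=
  forall x, exists2 y, Phi x y & `|g x - y| < eps.

End SetValued.

(* Main.v *)
Require Import Defs.
From HB Require Import structures.
From mathcomp Require Import all_boot all_order all_algebra finmap.
From mathcomp Require Import all_classical all_reals all_analysis.
From mathcomp Require Import lra.
Import Order.TTheory GRing.Theory Num.Theory.
Import numFieldNormedType.Exports.
Local Open Scope classical_set_scope.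
Local Open Scope ring_scope.

Set Implicit Arguments.
Unset Strict Implicit.
Unset Printing Implicit Defensive.

(** Since E is complete, it is enough to be able to improve approximate
    selections: for every eps there should be a gamma such that, whatever mu is,
    a continuous gamma-selection g can be moved by less than eps to a continuous
    mu-selection ([approximate_selection]).  Moving by eps/2, then eps/4, and so
    on, each time to a mu-selection with mu small enough for the next move,
    gives a uniformly Cauchy sequence; its limit takes values in the closures
    and is within eps of g.

    To improve g, put d = n + 1 and map X into a nerve of dimension at most d.
    A locally finite family of functions p_a : X -> [0, 1], such that at every
    point some p_a equals 1 and at most d + 1 of them are nonzero, sends z to the
    point (p_a z)_a of a cubical complex: the set of finitely supported points
    with coordinates in [0, 1], one of which is 1, divided into cells according
    to which coordinates are 0, 1, or strictly between.  At most d coordinates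
    of (p_a z)_a are strictly between.  If u is continuous on the cells of
    dimension at most d and sends every cell lying over z close to both Phi z
    and g z, then f z = u ((p_a z)_a) is the improved map.

    Such a u is found one dimension at a time ([skeletal_selection0],
    [skeletal_selectionS]).  Over a fixed point x, the boundary of a cell of
    dimension k + 1 goes near Phi x, and equi-LC lets it be filled near Phi x.
    The fillings over x have compact image, so by lower semi-continuity they
    are also near Phi z for all z in a neighbourhood of x.  A second family of
    functions, subordinate to these neighbourhoods, gives a finer complex with a
    dimension-nonincreasing map to the first one, and the fillings are pulled
    back along it; the neighbourhoods are chosen so that a cell lying over z is
    filled over a point whose neighbourhood contains z.  How far u moves away
    from g is governed by the diameters of the spheres alone, and not by their
    distance mu to the sets; this is why gamma can be chosen before mu.

    The spheres met here are only near the sets, whereas equi-LC fills spheres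
    inside them.  The passage is [exact_approx_filling]: a sphere near A is cut
    into small cubes, is approximated skeleton by skeleton by a sphere in A
    ([approx_skeleton]), and is joined to it by a thin collar.

    Finally, covering dimension speaks of finite covers while the nerve needs a
    locally finite one of order at most d.  This is Dowker's theorem
    [order_shrinking], proved here for paracompact spaces. *)

(** * Locally finite covers of paracompact spaces *)

Definition locally_finite_family (X : topologicalType) (I : Type)
    (U : I -> set X) : Prop :=
  forall x : X, exists2 N, nbhs x N & finite_set [set i | U i `&` N !=set0].

Definition covers (X I : Type) (U : I -> set X) : Prop :=
  forall x, exists i, U i x.

Lemma near_finite (T : Type) (F : set_system T) (I : choiceType) (S : set I)
    (P : I -> set T) : Filter F -> finite_set S ->
  (forall i, S i -> \forall x \near F, P i x) ->
  \forall x \near F, forall i, S i -> P i x.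
Proof.
move=> FF /finite_fsetP[s ->] h.
have : F (\bigcap_(i in [set` s]) P i) by apply: filter_bigI.
by apply: filterS => x hx i si; exact: hx.
Qed.

(** Members of a refining cover that were assigned to the same [O i] are merged,
    so that the refinement keeps the index type of the original cover. *)
Lemma paracompact_refine_family (X : topologicalType) (I : choiceType)
    (O : I -> set X) : paracompact_space X ->
  (forall i, open (O i)) -> covers O ->
  exists U : I -> set X, [/\ forall i, open (U i), forall i, U i `<=` O i,
    covers U & locally_finite_family U].
Proof.
move=> [_ par] oO cO.
have [[i0 _]|noI] := pselect (exists i : I, True); last first.
  exists O; split => //; first by move=> i x.
  by move=> x; have [i _] := cO x; exfalso; apply: noI; exists i.
have [|V [[oV cV] rV lV]] := par (range O).
  split; first by move=> _ [i _ <-]; exact: oO.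
  rewrite -subTset => x _; have [i Oix] := cO x.
  by exists (O i) => //; exists i.
have /choice[f fP] : forall B, exists i, V B -> B `<=` O i.
  move=> B.
  have [/rV[_ [i _ <-] sB]|nV] := pselect (V B); first by exists i.
  by exists i0.
exists (fun i => \bigcup_(B in [set B | V B /\ f B = i]) B); split.
- by move=> i; apply: bigcup_open => B [VB _]; exact: oV.
- by move=> i x [B [VB <-] Bx]; exact: fP VB x Bx.
- move=> x; have : [set: X] x by []; rewrite -cV => -[B VB Bx].
  by exists (f B); exists B.
- move=> x; have [N Nx fN] := lV x; exists N => //.
  apply: sub_finite_set (finite_image f fN) => i [y [[B [VB fB] By] Ny]].
  by exists B => //; split => //; exists y.
Qed.

Lemma locally_finite_closure (X : topologicalType) (I : choiceType)
    (U : I -> set X) (D : set I) (z : X) : locally_finite_family U ->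
  closure (\bigcup_(i in D) U i) z -> exists2 i, D i & closure (U i) z.
Proof.
move=> lU clz; apply: contrapT => nex.
have [N Nz fN] := lU z.
have : \forall y \near z, forall i, [set i | U i `&` N !=set0] i -> D i -> ~ U i y.
  apply: near_finite fN _ => i _.
  have [Di|nDi] := pselect (D i); last by near=> y.
  have /existsNP[B /not_implyP[Bz h]] : ~ closure (U i) z.
    by move=> h; apply: nex; exists i.
  near=> y => _ Uy; apply: h; exists y; split => //.
  by near: y; exact: Bz.
move=> nz; have [y [[i Di Uiy] [Ny h]]] := clz _ (filterI Nz nz).
by apply: (h i) => //; exists y.
Unshelve. all: by end_near. Qed.

Section Separation.
Variables (X : topologicalType) (par : paracompact_space X).

(** The local separations are refined to a locally finite cover; the closure of
    a locally finite union is the union of the closures, so the members meeting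
    [F] together still avoid [B].  With [B] a point this yields regularity, and
    then with [B] closed it yields normality. *)
Lemma paracompact_separate (F B : set X) : closed F ->
  (forall y, F y -> exists2 U, open U /\ U y & forall b, B b -> ~ closure U b) ->
  exists2 W, open W /\ F `<=` W & forall b, B b -> ~ closure W b.
Proof.
move=> cF hF.
pose good (A : set X) :=
  open A /\ ((forall b, B b -> ~ closure A b) \/ A `&` F = set0).
pose O (A : set X) := [set x | good A /\ A x].
have oO A : open (O A).
  have [gA|ngA] := pselect (good A).
    rewrite (_ : O A = A); first by case: gA.
    by apply/seteqP; split => x //; case.
  rewrite (_ : O A = set0); first exact: open0.
  by apply/seteqP; split => x //; case.
have cO : covers O.
  move=> x; have [/hF[U [oU Ux] hU]|nFx] := pselect (F x).
    by exists U; split => //; split => //; left.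
  exists (~` F); split => //; split; first exact: closed_openC.
  by right; rewrite setICl.
have [U [oU sU cU lU]] := paracompact_refine_family par oO cO.
exists (\bigcup_(A in [set A | U A `&` F !=set0]) U A).
  split; first by apply: bigcup_open.
  by move=> x Fx; have [A UAx] := cU x; exists A => //; exists x.
move=> b Bb /(locally_finite_closure lU)[A [y [UAy Fy]]] clb.
have [[_ [gA|gA]] Ay] := sU _ _ UAy.
  by apply: gA Bb _; apply: closure_subset clb => z /sU[].
by have : (A `&` F) y by []; rewrite gA.
Qed.

Lemma paracompact_regular (x : X) (O : set X) : open O -> O x ->
  exists2 W, open W /\ W x & closure W `<=` O.
Proof.
move=> oO Ox.
have [|y nOy|W [oW sW] hW] := @paracompact_separate (~` O) [set x].
- exact: open_closedC.
- have yx : y != x by apply/eqP => yx; apply: nOy; rewrite yx.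
  have := par.1; rewrite open_hausdorff => /(_ _ _ yx)[[A B] /=].
  rewrite !inE => -[Ay Bx] [oA oB AB0].
  exists A => // _ -> /(_ B (open_nbhs_nbhs (conj oB Bx)))[z ABz].
  by move: AB0 => /seteqP[/(_ z ABz)].
exists (~` closure W).
  split; first exact/closed_openC/closed_closure.
  exact: hW.
move=> y cly; apply: contrapT => nOy.
have [z [nWz Wz]] := cly _ (open_nbhs_nbhs (conj oW (sW _ nOy))).
by apply: nWz; exact: subset_closure.
Qed.

Lemma paracompact_normal (R : realType) : normal_space X.
Proof.
apply/(@normal_openP R) => A B cA cB AB0.
have [y Ay|W [oW sW] hW] := @paracompact_separate A B cA.
  have nBy : (~` B) y by move=> By; have : (A `&` B) y by []; rewrite AB0.
  have [W [oW Wy] sW] := paracompact_regular (closed_openC cB) nBy.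
  by exists W => // b Bb /sW.
exists W, (~` closure W); split => //.
- exact/closed_openC/closed_closure.
- by apply/seteqP; split => // x [Wx []]; exact: subset_closure.
Qed.

Lemma closed_shrinking (I : choiceType) (U : I -> set X) :
  (forall i, open (U i)) -> covers U ->
  exists G : I -> set X, [/\ forall i, closed (G i), forall i, G i `<=` U i &
    covers G].
Proof.
move=> oU cU.
pose good (A : set X) := open A /\ exists i, closure A `<=` U i.
have [[i0 _]|noI] := pselect (exists i : I, True); last first.
  exists (fun=> set0); split => [i|i x|x] //; first exact: closed0.
  by have [i _] := cU x; exfalso; apply: noI; exists i.
have /choice[f fP] : forall A, exists i, good A -> closure A `<=` U i.
  move=> A.
  have [[_ [i sA]]|nA] := pselect (good A); first by exists i.
  by exists i0.
have oO A : open [set x | good A /\ A x].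
  have [gA|ngA] := pselect (good A).
    rewrite (_ : mkset _ = A); first by case: gA.
    by apply/seteqP; split => x //; case.
  rewrite (_ : mkset _ = set0); first exact: open0.
  by apply/seteqP; split => x //; case.
have [|V [oV sV cV lV]] := paracompact_refine_family par oO.
  move=> x; have [i Uix] := cU x.
  have [W [oW Wx] sW] := paracompact_regular (oU i) Uix.
  by exists W; split => //; split => //; exists i.
exists (fun i => closure (\bigcup_(A in [set A | good A /\ f A = i]) V A)); split.
- by move=> i; exact: closed_closure.
- move=> i x /(locally_finite_closure lV)[A [gA <-]] clx.
  apply: (fP _ gA); apply: closure_subset clx => y Vy.
  by have [] := sV _ _ Vy.
- move=> x; have [A VAx] := cV x; have [gA Ax] := sV _ _ VAx.
  by exists (f A); apply: subset_closure; exists A.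
Qed.

End Separation.

(** * Covering dimension and locally finite covers *)

Definition family_order_le (X : Type) (I : choiceType) (U : I -> set X)
    (d : int) (z : X) : Prop :=
  forall s : {fset I}, (forall i, i \in s -> U i z) -> (#|` s|)%:Z <= d + 1.

Section OrderShrinking.
Variables (X : topologicalType) (d : int) (dimX : covering_dim_le X d).
Variable I : choiceType.

(** The members meeting [F], together with the complement of [F], form a finite
    cover, to which the definition of dimension applies.  Only the part of the
    cover inside [F] is changed. *)
Lemma order_shrinking_on_closed (U : I -> set X) (F : set X) :
  (forall i, open (U i)) -> covers U -> closed F ->
  finite_set [set i | U i `&` F !=set0] ->
  exists U' : I -> set X, [/\ forall i, open (U' i), forall i, U' i `<=` U i,
    covers U', (forall i z, ~ F z -> U i z -> U' i z) &
    forall z, F z -> family_order_le U' d z].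
Proof.
move=> oU cU cF finF.
pose C : set (set X) := U @` [set i | U i `&` F !=set0] `|` [set ~` F].
have finC : finite_set C.
  by rewrite finite_setU; split; [exact: finite_image|exact: finite_set1].
have [|V [_ [oV cV] rV ordV]] := dimX.2 C finC.
  split; first by move=> _ [[i _ <-]|->]; [exact: oU|exact: closed_openC].
  rewrite -subTset => x _; have [Fx|nFx] := pselect (F x).
    have [i Uix] := cU x.
    by exists (U i) => //; left; exists i => //; exists x.
  by exists (~` F) => //; right.
have [[i0 _]|noI] := pselect (exists i : I, True); last first.
  exists U; split => //; first by move=> i x.
  by move=> x; have [i _] := cU x; exfalso; apply: noI; exists i.
have /choice[f fP] : forall W, exists i, V W -> ~ (W `<=` ~` F) -> W `<=` U i.
  move=> W; have [VW|nVW] := pselect (V W); last by exists i0.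
  by have [_ [[i _ <-]|->] sW] := rV _ VW; [exists i|exists i0].
pose G i := \bigcup_(W in [set W | [/\ V W, ~ (W `<=` ~` F) & f W = i]]) W.
have sG i : G i `<=` U i by move=> z [W [VW nW <-]]; exact: fP.
have cG z : F z -> exists i, G i z.
  move=> Fz; have : [set: X] z by []; rewrite -cV => -[W VW Wz].
  by exists (f W), W => //; split => // /(_ _ Wz).
exists (fun i => (U i `&` ~` F) `|` G i); split.
- move=> i; apply: openU; first by apply: openI => //; exact: closed_openC.
  by apply: bigcup_open => W [VW _ _]; exact: oV.
- by move=> i z [[]//|/sG].
- move=> z; have [/cG[i Giz]|nFz] := pselect (F z); first by exists i; right.
  by have [i Uiz] := cU z; exists i; left.
- by move=> i z nFz Uiz; left.
- move=> z Fz s hs.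
  have /choice[g gP] : forall i, exists W : set X, i \in s -> [/\ V W, f W = i & W z].
    move=> i; have [si|nsi] := boolP (i \in s); last by exists set0.
    by have [[_ /(_ Fz)]//|[W [VW _ fW] Wz]] := hs _ si; exists W.
  have <- : #|` [fset g i | i in s]%fset| = #|` s|.
    apply/eqP/card_in_imfsetP => i j /gP[_ fi _] /gP[_ fj _] gij.
    by rewrite -fi -fj gij.
  apply: (ordV z) => B /imfsetP[i /= si ->].
  by have [] := gP _ si.
Qed.

(** Dowker's theorem.  Take a locally finite closed cover each member of which
    meets finitely many [U i], and reduce the order on one of its members at a
    time.  Around each point only finitely many steps change anything, so
    increasing chains of partial solutions have upper bounds, and Zorn's lemma
    gives a shrinking whose order has been reduced everywhere. *)
Lemma order_shrinking (U : I -> set X) : paracompact_space X ->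
  (forall i, open (U i)) -> covers U -> locally_finite_family U ->
  exists U' : I -> set X, [/\ forall i, open (U' i), forall i, U' i `<=` U i,
    covers U' & forall z, family_order_le U' d z].
Proof.
move=> par oU cU lU.
have [F [cF covF lF finF]] : exists F : set X -> set X,
    [/\ forall b, closed (F b), covers F, locally_finite_family F &
        forall b, finite_set [set i | U i `&` F b !=set0]].
  pose good (A : set X) :=
    open A /\ finite_set [set i | U i `&` closure A !=set0].
  have oO A : open [set x | good A /\ A x].
    have [gA|ngA] := pselect (good A).
      rewrite (_ : mkset _ = A); first by case: gA.
      by apply/seteqP; split => x //; case.
    rewrite (_ : mkset _ = set0); first exact: open0.
    by apply/seteqP; split => x //; case.
  have [|V [oV sV cV lV]] := paracompact_refine_family par oO.
    move=> x; have [N Nx fN] := lU x.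
    have [W [oW Wx] sW] :=
      paracompact_regular par (@open_interior _ N) Nx.
    exists W; split => //; split => //.
    apply: sub_finite_set fN => i [y [Uy /sW/interior_subset Ny]].
    by exists y.
  exists (fun A => closure (V A)); split.
  - by move=> A; exact: closed_closure.
  - by move=> x; have [A VAx] := cV x; exists A; exact: subset_closure.
  - move=> x; have [N Nx fN] := lV x; exists N°; first exact: nbhs_interior.
    apply: sub_finite_set fN => A [y [cly Ny]].
    have [z [Vz Nz]] := cly _ Ny.
    by exists z.
  - move=> A; have [[y VAy]|nVA] := pselect (exists y, V A y).
      have [[_ fA] _] := sV _ _ VAy.
      apply: sub_finite_set fA => i [z [Uz clz]]; exists z; split => //.
      by apply: closure_subset clz => w /sV[].
    rewrite (_ : mkset _ = set0); first exact: finite_set0.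
    apply/seteqP; split => // i [z [_ clz]].
    have [w [Vw _]] := clz _ filterT.
    by apply: nVA; exists w.
(* A partial solution is a set of indices of [F] already treated, together with
   the current shrinking of [U]. *)
pose partial (q : set (set X) * (I -> set X)) :=
  [/\ forall i, open (q.2 i), forall i, q.2 i `<=` U i, covers q.2 &
      forall z b, q.1 b -> F b z -> family_order_le q.2 d z].
pose le (q r : {q | partial q}) := `[< [/\ (projT1 q).1 `<=` (projT1 r).1,
  forall i, (projT1 r).2 i `<=` (projT1 q).2 i &
  forall i z, (projT1 q).2 i z ->
    (forall b, (projT1 r).1 b -> ~ (projT1 q).1 b -> ~ F b z) ->
    (projT1 r).2 i z] >].
have p0 : partial (set0, U) by split => // i x.
(* A later solution may differ from an earlier one only on members of [F]
   treated in between; this is what makes intersections of chains open. *)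
have [||C totC|[[B W] pW] maxW] := @ZL_preorder _ (exist _ _ p0) le.
- move=> q; apply/asboolP; split => [b|i z|i z] //.
- move=> q r t /asboolP[s1 u1 v1] /asboolP[s2 u2 v2]; apply/asboolP; split.
  + by move=> b /s1/s2.
  + by move=> i x /u2/u1.
  + move=> i z qz h; apply: v2; last by move=> b tb nrb; apply: h => // /s1.
    by apply: v1 => // b rb nqb; apply: h => //; exact: s2.
- have [C0|/set0P[q0 Cq0]] := eqVneq C set0.
    by exists (exist _ _ p0) => s; rewrite C0.
  pose Bs := \bigcup_(q in C) (projT1 q).1.
  pose Ws i := \bigcap_(q in C) (projT1 q).2 i.
  have dominate (S : set (set X)) : finite_set S -> S `<=` Bs ->
      exists2 q, C q & S `<=` (projT1 q).1.
    move=> /finite_fsetP[s ->]; elim/finSet_rect: s => s IH sS.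
    have [->|/fset0Pn[b bs]] := eqVneq s fset0; first by exists q0.
    have [|b' /= b's|q Cq sq] := IH (s `\ b)%fset; first exact: fproperD1.
      by apply: sS => /=; move: b's; rewrite !inE => /andP[].
    have [r Cr rb] := sS _ bs.
    have [/asboolP[sqr _ _]|/asboolP[srq _ _]] := totC _ _ Cq Cr.
      exists r => // b' /= b's; have [->//|nb] := eqVneq b' b.
      by apply: sqr; apply: sq => /=; rewrite !inE nb.
    exists q => // b' /= b's; have [->|nb] := eqVneq b' b; first exact: srq.
    by apply: sq => /=; rewrite !inE nb.
  have stable (x : X) : exists2 N, nbhs x N &
      exists2 q, C q & forall i z, N z -> (projT1 q).2 i z -> Ws i z.
    have [N Nx fN] := lF x; exists N => //.
    have [||q Cq sq] := dominate [set b | Bs b /\ F b `&` N !=set0].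
    - by apply: sub_finite_set fN => b [].
    - by move=> b [].
    exists q => // i z Nz qz r Cr.
    have [/asboolP[_ _ vqr]|/asboolP[_ + _]] := totC _ _ Cq Cr; last exact.
    apply: vqr => // b rb nqb Fbz; apply: nqb; apply: sq; split.
      by exists r.
    by exists z.
  have pWs : partial (Bs, Ws).
    split => /=.
    + move=> i; rewrite openE => x Wx.
      have [N Nx [q Cq hq]] := stable x.
      have [oq _ _ _] := projT2 q.
      have qx : nbhs x ((projT1 q).2 i).
        by apply: open_nbhs_nbhs; split => //; exact: Wx.
      by apply: filterS (filterI Nx qx) => z [Nz qz]; exact: hq.
    + by move=> i x /(_ _ Cq0); have [_ + _ _] := projT2 q0; apply.
    + move=> x; have [N Nx [q Cq hq]] := stable x.
      have [_ _ cq _] := projT2 q; have [i qi] := cq x.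
      by exists i; apply: hq => //; exact: nbhs_singleton.
    + move=> z b [q Cq qb] Fbz s hs.
      have [_ _ _ oq] := projT2 q.
      by apply: oq qb Fbz _ _ => i /hs; apply.
  exists (exist _ _ pWs) => q Cq; apply/asboolP; split => /=.
  + by move=> b qb; exists q.
  + by move=> i x; apply.
  + move=> i z qz h r Cr.
    have [/asboolP[_ _ vqr]|/asboolP[_ + _]] := totC _ _ Cq Cr; last exact.
    by apply: vqr => // b rb nqb; apply: h => //; exists r.
have [/= oW sW cW ordW] := pW.
have full b : B b.
  apply: contrapT => nBb.
  have [|W' [oW' sW' cW' eW' ordW']] := order_shrinking_on_closed oW cW (cF b).
    by apply: sub_finite_set (finF b) => i [z [/sW ? ?]]; exists z.
  have pW' : partial (B `|` [set b], W').
    split => //=; first by move=> i x /sW'/sW.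
    move=> z b' [Bb'|->]; last exact: ordW'.
    by move=> Fz s hs; apply: ordW Bb' Fz _ _ => i /hs/sW'.
  have /maxW/asboolP[sB _ _] : le (exist _ _ pW) (exist _ _ pW').
    apply/asboolP; split => /=; first by move=> b' ?; left.
      exact: sW'.
    move=> i z Wz h.
    by apply: eW' => //; apply: h => //; right.
  by apply: nBb; apply: sB; right.
exists W; split => // z; have [b Fbz] := covF z.
exact: ordW (full b) Fbz.
Qed.

End OrderShrinking.

(** A partition of unity normalized by its supremum rather than by its sum: the
    values at a point are then the coordinates of a point of a cubical complex
    instead of barycentric coordinates. *)
Record bump_system (R : realType) (X : topologicalType) (I : choiceType)
    (p : I -> X -> R) : Prop := BumpSystem {
  bump_cont : forall i, continuous (p i);
  bump_ge0 : forall i z, 0 <= p i z;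
  bump_le1 : forall i z, p i z <= 1;
  bump_eq1 : forall z, exists i, p i z = 1;
  bump_finite : locally_finite_family (fun i => [set z | 0 < p i z]) }.

Lemma subordinate_bumps (R : realType) (X : topologicalType) (I : choiceType)
    (d : int) (O : I -> set X) :
  paracompact_space X -> covering_dim_le X d ->
  (forall i, open (O i)) -> covers O ->
  exists p : I -> X -> R, [/\ bump_system p, forall i z, 0 < p i z -> O i z &
    forall z, family_order_le (fun i => [set y | 0 < p i y]) d z].
Proof.
move=> par dimX oO cO.
have [U [oU sU cU lU]] := paracompact_refine_family par oO cO.
have [V [oV sV cV ordV]] := order_shrinking dimX par oU cU lU.
have [G [cG sG covG]] := closed_shrinking par oV cV.
pose p i := @Urysohn X R (~` V i) (G i).
have sep i : uniform_separator (~` V i) (G i).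
  apply: (normal_uniform_separator (paracompact_normal par R)) => //.
    exact: open_closedC.
  by apply/seteqP; split => // z [nV /sG].
have p01 i z : 0 <= p i z <= 1.
  have /= := @Urysohn_range X R (~` V i) (G i) (p i z) (ex_intro2 _ _ z Logic.I erefl).
  by rewrite in_itv.
have pV i z : 0 < p i z -> V i z.
  move=> p0; apply: contrapT => nV.
  have : p i z = 0 by apply: (Urysohn_sub0 (sep i)); exists z.
  by move=> pz; rewrite pz ltxx in p0.
exists p; split.
- split.
  + by move=> i; exact: Urysohn_continuous.
  + by move=> i z; have /andP[] := p01 i z.
  + by move=> i z; have /andP[] := p01 i z.
  + move=> z; have [i Giz] := covG z; exists i.
    by apply: (Urysohn_sub1 (sep i)); exists z.
  + move=> z; have [N Nz fN] := lU z; exists N => //.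
    by apply: sub_finite_set fN => i [y [/pV/sV Uy Ny]]; exists y.
- by move=> i z /pV/sV/sU.
- by move=> z s hs; apply: (ordV z) => i /hs/pV.
Qed.

(** * Cells of the integer cubical grid *)

Section Cells.
Variables (R : realType).

(** [a] lies in the closure of the open cell of [R], cut at the integers, that
    contains [b].  Comparing with all integers instead of using floor and
    ceiling makes reflexivity, transitivity and the compatibility with monotone
    operations immediate. *)
Definition face1 (a b : R) : Prop :=
  forall m : int, (m%:~R <= b -> m%:~R <= a) /\ (b <= m%:~R -> a <= m%:~R).

Lemma face1_int (a b : R) : face1 a b -> b \is a Num.int -> a = b.
Proof.
move=> ab /intrP[m bm]; apply/eqP; rewrite eq_le.
by have [h1 h2] := ab m; rewrite bm h1 ?h2 // bm.
Qed.

Lemma face1_itv (a b : R) : b \isn't a Num.int ->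
  face1 a b <-> (Num.floor b)%:~R <= a <= (Num.floor b)%:~R + 1.
Proof.
move=> nb; have /andP[fb bf] := floor_itv b.
have fb' : (Num.floor b)%:~R < b.
  by rewrite lt_neqAle fb andbT -intrEfloor.
rewrite intrD in bf; split.
  move=> ab; have [-> //] := ab (Num.floor b).
  have [_] := ab (Num.floor b + 1).
  by rewrite intrD => -> //; exact: ltW.
move=> /andP[fa af] m; split.
  rewrite -floor_ge_int => mb; apply: le_trans fa.
  by rewrite ler_int.
move=> bm; apply: (le_trans af); rewrite -[1]/(1%:~R) -intrD ler_int.
by rewrite lezD1 -(ltr_int R); exact: lt_le_trans bm.
Qed.

(** A point near [y] belongs to one of the at most three cells that have [y] in
    their closure, and the cell is determined by the side of [y] on which the
    point lies. *)
Lemma face1_near (y : R) : exists e, [/\ 0 < e,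
  forall z, `|y - z| < e -> face1 y z &
  forall z z', `|y - z| < e -> `|y - z'| < e ->
    (z < y) = (z' < y) -> (y < z) = (y < z') -> face1 z' z].
Proof.
have /andP[fy yf] := floor_itv y; have /andP[cy yc] := ceil_itv y.
rewrite !intrD /= in yf cy.
set f : R := (Num.floor y)%:~R in fy yf; set c : R := (Num.ceil y)%:~R in cy yc.
pose e := Num.min (y - (c - 1)) (f + 1 - y).
have e0 : 0 < e by rewrite lt_min; apply/andP; split; lra.
have he z : `|y - z| < e -> c - 1 < z < f + 1.
  by rewrite lt_min !ltr_norml => /andP[/andP[_ h1] /andP[h2 _]]; lra.
have floorP (m : int) z : z < f + 1 -> m%:~R <= z -> m%:~R <= f.
  move=> zf mz; rewrite ler_int -ltzD1 -(ltr_int R) intrD.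
  exact: le_lt_trans zf.
have ceilP (m : int) z : c - 1 < z -> z <= m%:~R -> c <= m%:~R.
  move=> zc zm; rewrite ler_int -ltzD1 -(ltr_int R) intrD -ltrBlDr.
  exact: lt_le_trans zm.
exists e; split => //.
  move=> z /he/andP[cz zf] m; split => [/(floorP _ _ zf)|/(ceilP _ _ cz)] h.
    exact: le_trans fy.
  exact: le_trans h.
move=> z z' /he/andP[cz zf] /he/andP[cz' zf'] h1 h2.
have [zy|zy|zy] := ltgtP z y.
- rewrite zy in h1; move=> m; split.
    move=> mz; apply: ltW; apply: le_lt_trans cz'.
    have : m%:~R < c by apply: lt_le_trans yc; exact: le_lt_trans zy.
    rewrite ltr_int -lezD1 -(ler_int R) intrD -/c /=; lra.
  move/(ceilP _ _ cz) => cm; apply: ltW; apply: lt_le_trans cm.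
  by apply: lt_le_trans yc; rewrite -h1.
- rewrite zy in h2; move=> m; split.
    move/(floorP _ _ zf) => mf; apply: (le_trans mf); apply: (le_trans fy).
    by apply: ltW; rewrite -h2.
  move=> zm; have : f < m%:~R by apply: le_lt_trans fy _; exact: lt_le_trans zm.
  rewrite ltr_int -lezD1 -(ler_int R) intrD -/f /=; lra.
- have -> : z' = z.
    rewrite zy !ltxx in h1 h2; rewrite zy.
    by apply/eqP; rewrite eq_le !leNgt -h1 -h2.
  by move=> m; split.
Qed.

Variable I : choiceType.
Implicit Types s t : I -> R.

(** Cells have no representation of their own: the closed cell that contains
    [t] in its interior is the set of all [s] with [face s t]. *)
Definition face s t : Prop := forall i, face1 (s i) (t i).

Definition dim_le t (k : nat) : Prop :=
  exists J : {fset I}, (#|` J| <= k)%N /\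
    forall i, i \notin J -> t i \is a Num.int.

Definition cell t : set (I -> R) := [set s | face s t].

Lemma face_refl t : face t t.
Proof. by move=> i m. Qed.

Lemma face_trans s t r : face s t -> face t r -> face s r.
Proof.
move=> st tr i m; have [h1 h2] := st i m; have [h3 h4] := tr i m.
by split => [/h3/h1|/h4/h2].
Qed.

Lemma dim_le_face s t k : face s t -> dim_le t k -> dim_le s k.
Proof.
move=> st [J [Jk hJ]]; exists J; split => // i /hJ ti.
by rewrite (face1_int (st i) ti).
Qed.

Lemma dim_le0_face s t : dim_le t 0 -> face s t -> s = t.
Proof.
move=> [J []]; rewrite leqn0 cardfs_eq0 => /eqP -> hJ st.
by apply/funext => i; apply: face1_int (st i) (hJ _ _).
Qed.

Lemma exact_dim t k : dim_le t k.+1 -> ~ dim_le t k ->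
  exists2 J : {fset I}, #|` J| = k.+1 &
    forall i, (i \in J) = (t i \isn't a Num.int).
Proof.
move=> [J [Jk hJ]] ndim.
have JE i : (i \in J) = (t i \isn't a Num.int).
  apply/idP/idP => [iJ|]; last by apply: contraNT => /hJ.
  apply/negP => ti; apply: ndim; exists (J `\ i)%fset; split.
    by have := cardfsD1 i J; rewrite iJ => JE; rewrite JE in Jk.
  by move=> j; rewrite !inE negb_and negbK => /orP[/eqP->|/hJ].
exists J => //; apply/eqP; rewrite eqn_leq Jk ltnNge; apply/negP => Jk'.
by apply: ndim; exists J.
Qed.

(** A proper face has at least one more integer coordinate. *)
Lemma face_eq_dim s t k : face s t -> dim_le t k.+1 -> ~ dim_le s k -> face t s.
Proof.
move=> st tk nsk.
have ntk : ~ dim_le t k by move=> tk'; apply: nsk; exact: dim_le_face st tk'.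
have [K Kk KE] := exact_dim tk ntk; move=> i.
have [ti|ti] := boolP (t i \is a Num.int).
  by rewrite (face1_int (st i) ti).
have si : s i \isn't a Num.int.
  apply/negP => si; apply: nsk; exists (K `\ i)%fset; split.
    have iK : i \in K by rewrite KE.
    by have := cardfsD1 i K; rewrite iK Kk add1n => -[->].
  move=> j; rewrite !inE negb_and negbK => /orP[/eqP-> //|].
  by rewrite KE negbK => tj; rewrite (face1_int (st j) tj).
have /(face1_itv _ ti)/andP[h1 h2] := st i.
suff -> : face1 (t i) (s i) <-> True by [].
split => // _; apply/(face1_itv _ si).
suff -> : Num.floor (s i) = Num.floor (t i).
  by apply/(face1_itv _ ti) => m.
apply: floor_def; rewrite h1 intrD /= lt_neqAle h2 andbT.
apply: contraNneq si => ->; rewrite -[1]/(1%:~R) -intrD; exact: intr_int.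
Qed.

End Cells.

(** * Maps that are continuous on every cell *)

Section Gluing.
Variables (R : realType) (E : normedModType R) (I : choiceType).
Implicit Types (s t : I -> R) (u w : (I -> R) -> E) (C : set (I -> R)).

(** Continuity on [C] for the supremum distance; on a cell of finite dimension
    this is the usual topology of a cube. *)
Definition supcont C u : Prop :=
  forall s, C s -> forall e, 0 < e -> exists2 d, 0 < d &
    forall t, C t -> (forall i, `|s i - t i| < d) -> `|u s - u t| < e.

Section Glue.
Variables (Y : Type) (F : set_system Y) (q : Y -> I -> R).
Variables (s0 : I -> R) (T : {fset I}).
Hypothesis FF : Filter F.
Hypothesis constq : \forall y \near F, forall i, i \notin T -> q y i = s0 i.
Hypothesis cvgq : forall i, i \in T -> q y i @[y --> F] --> s0 i.

Let near_coord (e : I -> R) : (forall i, 0 < e i) ->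
  \forall y \near F, forall i, `|s0 i - q y i| < e i.
Proof.
move=> e0.
have h : \forall y \near F, forall i, i \in T -> `|s0 i - q y i| < e i.
  apply: (@near_finite _ F I [set` T] (fun i y => `|s0 i - q y i| < e i)) => //.
  by move=> i /= iT; move/cvgrPdist_lt: (cvgq iT) => /(_ _ (e0 i)).
apply: filterS2 constq h => y cy hy i.
by have [/hy//|/cy ->] := boolP (i \in T); rewrite subrr normr0.
Qed.

Lemma near_face : \forall y \near F, face s0 (q y).
Proof.
have [e eP] := choice (fun i => face1_near (s0 i)).
have e0 i : 0 < e i by have := eP i; case.
by apply: filterS (near_coord e0) => y hy i; have [_ h _] := eP i; exact: h.
Qed.

(** This replaces the gluing of continuous maps along a locally finite closed
    cover.  Near its limit [s0], [q y] stays in finitely many cells, all having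
    [s0] in their closure: they are distinguished by the sides of [s0 i] on which
    the finitely many varying coordinates lie. *)
Lemma glue u : (\forall y \near F, supcont (cell (q y)) u) ->
  u (q y) @[y --> F] --> u s0.
Proof.
move=> cu.
have [e eP] := choice (fun i => face1_near (s0 i)).
have e0 i : 0 < e i by have := eP i; case.
apply/cvgrPdist_lt => eps eps0.
pose M := [set y | [/\ forall i, i \notin T -> q y i = s0 i,
  forall i, `|s0 i - q y i| < e i & supcont (cell (q y)) u]].
have FM : F M.
  by apply: filterS3 constq (near_coord e0) cu => y ? ? ?; split.
have fM y : M y -> face s0 (q y).
  by move=> [_ hy _] i; have [_ h _] := eP i; exact: h.
pose pat y := [ffun i : T => (q y (val i) < s0 (val i), s0 (val i) < q y (val i))].
suff : \forall y \near F, forall f, pat y = f -> `|u s0 - u (q y)| < eps.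
  by apply: filterS => y; apply.
apply: filter_forall => f.
have [[y0 [My0 py0]]|no] := pselect (exists y0, M y0 /\ pat y0 = f); last first.
  by apply: filterS FM => y My py; exfalso; apply: no; exists y.
have [_ _ /(_ _ (fM _ My0) _ eps0)[d d0 hd]] := My0.
apply: filterS2 FM (near_coord (fun=> d0)) => y My hy py.
apply: hd => // i; have [cy0 hy0 _] := My0; have [cy hy' _] := My.
have [iT|niT] := boolP (i \in T); last first.
  by rewrite cy // -cy0 // => m.
have [_ _ h] := eP i.
have := congr1 (fun g : {ffun T -> bool * bool} => g [` iT]%fset) (etrans py0 (esym py)).
by rewrite !ffunE /= => -[h1 h2]; apply: h.
Qed.

End Glue.

Lemma supcont_eq C u w : (forall s, C s -> u s = w s) -> supcont C u ->
  supcont C w.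
Proof.
move=> uw cu s Cs e e0; have [d d0 hd] := cu _ Cs _ e0.
by exists d => // t Ct st; rewrite -!uw //; exact: hd.
Qed.

End Gluing.

Lemma rV_norm_leP (R : realType) n (r : 'rV[R]_n) (x : R) : 0 <= x ->
  reflect (forall j, `|r ord0 j| <= x) (`|r| <= x).
Proof.
move=> x0; apply: (iffP idP) => [rx j|h].
  apply: le_trans rx; rewrite /Num.norm /= mx_normrE.
  exact: (le_bigmax 0 (fun ij : 'I_1 * 'I_n => `|r ij.1 ij.2|) (ord0, j)).
rewrite /Num.norm /= mx_normrE; apply/bigmax_leP; split => // -[i j] _.
by rewrite ord1.
Qed.

Lemma rV_coord_le (R : realType) n (r : 'rV[R]_n) j : `|r ord0 j| <= `|r|.
Proof. by move: j; apply/rV_norm_leP. Qed.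

Lemma rV_norm_eq (R : realType) n (r : 'rV[R]_n.+1) :
  exists j, `|r| = `|r ord0 j|.
Proof.
have [j _ hj] := @arg_maxP _ R 'I_n.+1 ord0 xpredT (fun j => `|r ord0 j|) isT.
exists j; apply/eqP; rewrite eq_le; apply/andP; split.
  by apply/rV_norm_leP => // i; exact: hj.
by move: j {hj}; apply/rV_norm_leP.
Qed.

Section Filling.
Variables (R : realType) (E : normedModType R).

Definition cont_within (T : topologicalType) (D : set T) (u : T -> E) : Prop :=
  forall r, D r -> u r' @[r' --> within D (nbhs r)] --> u r.

Definition sup_sphere k : set 'rV[R]_k.+1 := [set r | `|r| = 1].
Definition sup_ball k : set 'rV[R]_k.+1 := [set r | `|r| <= 1].

(** Spheres and balls are those of the supremum norm of ['rV[R]_k.+1]; they are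
    thus the boundary and the whole of a cube.  The two sets record which
    constraint on a sphere gives which control on its filling. *)
Definition fills k (P Q : set E) : Prop :=
  forall u : 'rV[R]_k.+1 -> E, cont_within (@sup_sphere k) u ->
    (forall r, `|r| = 1 -> P (u r)) ->
  exists v, [/\ cont_within (@sup_ball k) v, forall r, `|r| = 1 -> v r = u r &
    forall r, `|r| <= 1 -> Q (v r)].

Lemma fset_coords (I : choiceType) (J : {fset I}) k : #|` J| = k.+1 ->
  exists (c : 'I_k.+1 -> I) (idx : I -> 'I_k.+1),
    [/\ forall j, c j \in J, cancel c idx & {in J, cancel idx c}].
Proof.
move=> Jk; have [x0 x0J] : exists x, x \in J.
  by apply/fset0Pn; rewrite -cardfs_gt0 Jk.
exists (fun j => nth x0 J j), (fun i => inord (index i J)); split.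
- by move=> j; apply: mem_nth; rewrite -[size _]/#|` J| Jk.
- move=> j; apply: val_inj; rewrite /= index_uniq ?inordK //.
  by rewrite -[size _]/#|` J| Jk.
- move=> i iJ /=; rewrite inordK ?nth_index //.
  by rewrite -Jk; rewrite index_mem.
Qed.

(** The cell of [t0] is an affine cube, whose proper faces together consist of its
    points with fewer noninteger coordinates. *)
Lemma cell_fill k (P Q : set E) (I : choiceType) (t0 : I -> R)
    (u : (I -> R) -> E) :
  fills k P Q -> dim_le t0 k.+1 -> ~ dim_le t0 k ->
  (forall s, face s t0 -> dim_le s k -> supcont (cell s) u /\ P (u s)) ->
  exists w, [/\ supcont (cell t0) w,
    forall s, face s t0 -> dim_le s k -> w s = u s &
    forall s, face s t0 -> Q (w s)].
Proof.
move=> fl tk ntk hu.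
have [J Jk JE] := exact_dim tk ntk.
have [c [idx [cJ cK idxK]]] := fset_coords Jk.
pose fl0 i : R := (Num.floor (t0 i))%:~R.
pose phi (r : 'rV[R]_k.+1) i :=
  if i \in J then fl0 i + (1 + r ord0 (idx i)) / 2 else t0 i.
pose psi (s : I -> R) : 'rV[R]_k.+1 := \row_j (2 * (s (c j) - fl0 (c j)) - 1).
have psiK s : face s t0 -> phi (psi s) = s.
  move=> st; apply/funext => i; rewrite /phi; case: ifPn => [iJ|].
    by rewrite mxE idxK //; lra.
  by rewrite JE negbK => /(face1_int (st i)).
have phi_face r : `|r| <= 1 -> face (phi r) t0.
  move=> /(rV_norm_leP _ ler01) r1 i; rewrite /phi; case: ifPn => [iJ|_ //].
  apply/face1_itv; first by rewrite -JE.
  by have := r1 (idx i); rewrite ler_norml -/(fl0 i); lra.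
have psi_ball s : face s t0 -> `|psi s| <= 1.
  move=> st; apply/rV_norm_leP => // j; rewrite mxE.
  have := st (c j); rewrite face1_itv -?JE // -/(fl0 _) ler_norml; lra.
have phi_dim r : `|r| = 1 -> dim_le (phi r) k.
  move=> r1; have [j rj] := rV_norm_eq r.
  exists (J `\ c j)%fset; split.
    by have := cardfsD1 (c j) J; rewrite cJ Jk add1n => -[<-].
  move=> i; rewrite !inE negb_and negbK => /orP[/eqP->|niJ].
    rewrite /phi cJ cK; have : `|r ord0 j| = 1 by rewrite -rj.
    move=> /eqP; rewrite eqr_norml => /andP[/orP[]/eqP-> _].
      rewrite (_ : _ / 2 = 1); last lra.
      by rewrite /fl0 -[1]/(1%:~R) -intrD; exact: intr_int.
    rewrite subrr mul0r addr0; exact: intr_int.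
  by rewrite /phi (negbTE niJ); move: niJ; rewrite JE negbK.
have psi_sphere s : face s t0 -> dim_le s k -> `|psi s| = 1.
  move=> st sk; apply/eqP; rewrite eq_le psi_ball //=.
  have : exists2 i, i \in J & s i \is a Num.int.
    apply: contrapT => nex; have [K [Kk KE]] := sk.
    have /fsubset_leq_card : (J `<=` K)%fset.
      apply/fsubsetP => i iJ; apply: contrapT => /negP/KE si.
      by apply: nex; exists i.
    by rewrite Jk leqNgt ltnS Kk.
  move=> [i iJ si].
  have : `|psi s ord0 (idx i)| = 1.
    rewrite mxE idxK //.
    have ni : t0 i \isn't a Num.int by rewrite -JE.
    have /(face1_itv _ ni)/andP[h1 h2] := st i.
    move: si h1 h2 => /intrP[m ->]; rewrite /fl0 ler_int.
    rewrite -[1 in X in _ -> X -> _]/(1%:~R) -intrD ler_int => h1 h2.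
    have [->|->] : m = Num.floor (t0 i) \/ m = Num.floor (t0 i) + 1.
      have [|h3] := leP m (Num.floor (t0 i)).
        by left; apply/eqP; rewrite eq_le h1 andbT.
      by right; apply/eqP; rewrite eq_le h2 lezD1.
    - by rewrite subrr mulr0 sub0r normrN normr1.
    - rewrite intrD /=; rewrite (_ : _ - 1 = 1) ?normr1 //; lra.
  move=> <-; exact: rV_coord_le.
have le1 (r : 'rV[R]_k.+1) : `|r| = 1 -> `|r| <= 1 by move=> ->.
have [||v [cv vu Qv]] := fl (u \o phi).
- move=> r r1; apply: (@glue _ _ _ _ _ phi (phi r) J).
  + by near=> r' => i niJ; rewrite /phi (negbTE niJ).
  + move=> i iJ; apply: cvg_within_filter; rewrite /phi iJ.
    apply: cvgD; first exact: cvg_cst.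
    apply: cvgM; last exact: cvg_cst.
    apply: cvgD; first exact: cvg_cst.
    exact: coord_continuous.
  + near=> r'; have r'1 : `|r'| = 1 by near: r'; exact: withinT.
    by have [] := hu (phi r') (phi_face _ (le1 _ r'1)) (phi_dim _ r'1).
- by move=> r r1; have [] := hu (phi r) (phi_face _ (le1 _ r1)) (phi_dim _ r1).
exists (v \o psi); split => /=.
- move=> s st e e0.
  have /cvgrPdist_lt/(_ _ e0) := cv _ (psi_ball _ st).
  rewrite near_withinE => /nbhs_ballP[d /= d0 hd].
  exists (d / 4); first lra.
  move=> t tt std; apply: hd; last exact: psi_ball.
  rewrite -ball_normE /=; apply: (@le_lt_trans _ _ (d / 2)); last lra.
  apply/rV_norm_leP => [|j]; first lra.
  rewrite !mxE; have := std (c j); rewrite ler_norml ltr_norml; lra.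
- by move=> s st sk; rewrite vu ?psi_sphere //= psiK.
- by move=> s st; apply: Qv; exact: psi_ball.
Unshelve. all: by end_near. Qed.

(** Fillings of the (k+1)-cells fit together, since two cells meet only in their
    k-skeletons.  The filling is chosen as a function of the set [cell t], so that
    all points of an open cell use the same one. *)
Lemma skeleton_step k (I : choiceType) (K : set (I -> R)) (u : (I -> R) -> E)
    (G : (I -> R) -> set E) :
  (forall s t, face s t -> K t -> K s) ->
  (forall t, K t -> dim_le t k -> supcont (cell t) u) ->
  (forall t, K t -> dim_le t k.+1 -> ~ dim_le t k -> exists P Q,
    [/\ fills k P Q, forall s, face s t -> dim_le s k -> P (u s) &
        forall s, face s t -> Q `<=` G s]) ->
  exists u', [/\ forall t, dim_le t k -> u' t = u t,
    forall t, K t -> dim_le t k.+1 -> supcont (cell t) u' &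
    forall t, K t -> dim_le t k.+1 -> ~ dim_le t k -> G t (u' t)].
Proof.
move=> Kface cu hfill.
have /choice[w wP] : forall C : set (I -> R), exists w : (I -> R) -> E,
    forall t, K t -> dim_le t k.+1 -> ~ dim_le t k -> cell t = C ->
    [/\ supcont (cell t) w, forall s, face s t -> dim_le s k -> w s = u s &
      forall s, face s t -> G s (w s)].
  move=> C; have [[t [Kt tk ntk tC]]|no] :=
      pselect (exists t, [/\ K t, dim_le t k.+1, ~ dim_le t k & cell t = C]).
    have [P [Q [fl hP hQ]]] := hfill t Kt tk ntk.
    have [|w [cw wu Qw]] := @cell_fill k P Q I t u fl tk ntk.
      move=> s st sk; split; last exact: hP.
      by apply: cu => //; exact: Kface Kt.
    exists w => t' Kt' tk' ntk' tC'.
    have tt' : cell t' = cell t by rewrite tC' -tC.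
    have tt's s : face s t' -> face s t by rewrite -[face s t']/(cell t' s) tt'.
    split; first by rewrite tt'.
      by move=> s /tt's st sk; exact: wu.
    by move=> s /tt's st; apply: (hQ _ st); exact: Qw.
  exists u => t Kt tk ntk tC; exfalso; apply: no; by exists t.
pose u' t := if pselect (dim_le t k) then u t else w (cell t) t.
have u'k t : dim_le t k -> u' t = u t by rewrite /u'; case: pselect.
have u'E s t : K t -> dim_le t k.+1 -> ~ dim_le t k -> face s t ->
    u' s = w (cell t) s.
  move=> Kt tk ntk st; rewrite /u'; case: pselect => [sk|nsk].
    by have [_ -> //] := wP _ t Kt tk ntk erefl.
  have ts := face_eq_dim st tk nsk.
  congr (w _ _); apply/seteqP; split => r /= h; exact: face_trans h _.
exists u'; split => //.
- move=> t Kt tk1; have [tk|ntk] := pselect (dim_le t k).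
    apply: supcont_eq (cu _ Kt tk) => s st.
    by rewrite u'k //; exact: dim_le_face st tk.
  have [cw _ _] := wP _ t Kt tk1 ntk erefl.
  by apply: supcont_eq cw => s st; rewrite (u'E _ t).
- move=> t Kt tk ntk; rewrite (u'E t t Kt tk ntk (face_refl t)).
  by have [_ _] := wP _ t Kt tk ntk erefl; apply; exact: face_refl.
Qed.

End Filling.

(** * Filling spheres in a set and near a set *)

Section Filling_Properties.
Variables (R : realType) (E : normedModType R).
Implicit Types (S : set (set E)) (A : set E) (e : E).

Definition nball e (d : R) : set E := [set y | `|e - y| < d].
Definition thicken A (d : R) : set E := [set z | exists2 y, A y & `|z - y| < d].

Definition exact_filling S (k : nat) : Prop :=
  forall eps, 0 < eps -> exists2 delta, 0 < delta &
  forall A e, S A -> fills k (A `&` nball e delta) (A `&` nball e eps).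

(** [delta], which bounds the size of the spheres, is chosen before the closeness
    [eta] to [A] that is prescribed for the fillings. *)
Definition approx_filling S (k : nat) : Prop :=
  forall eps, 0 < eps -> exists2 delta, 0 < delta &
  forall eta, 0 < eta -> exists2 mu, 0 < mu &
  forall A e, S A ->
    fills k (thicken A mu `&` nball e delta) (thicken A eta `&` nball e eps).

Lemma cvg_within_comp (T T' : topologicalType) (D : set T) (D' : set T')
    (h : T -> T') (u : T' -> E) :
  (forall r, D r -> h r' @[r' --> within D (nbhs r)] --> h r) ->
  (forall r, D r -> D' (h r)) -> cont_within D' u ->
  cont_within D (u \o h).
Proof.
move=> ch hD cu r Dr U /(cu _ (hD _ Dr)) /= hU.
have := ch r Dr _ hU; apply: filterS2 (withinT _ _) => r' Dr' /=.
by apply; exact: hD.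
Qed.

Let norm2 k (r : 'rV[R]_k) : R := Num.sqrt (\sum_i r ord0 i ^+ 2).

Let norm2_sqr k (r : 'rV[R]_k) : norm2 r ^+ 2 = \sum_i r ord0 i ^+ 2.
Proof. by rewrite sqr_sqrtr // sumr_ge0 // => i _; exact: sqr_ge0. Qed.

Let norm2_ge k (r : 'rV[R]_k) : `|r| <= norm2 r.
Proof.
apply/rV_norm_leP => [|j]; first exact: sqrtr_ge0.
rewrite -sqrtr_sqr; apply: ler_wsqrtr; rewrite (bigD1 j) //= lerDl.
by rewrite sumr_ge0 // => i _; exact: sqr_ge0.
Qed.

Let norm2_continuous k : continuous (@norm2 k).
Proof.
have sum_cont : continuous (fun r : 'rV[R]_k => \sum_i r ord0 i ^+ 2 : R).
  apply: (@continuous_big R^o); first exact: add_continuous.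
  move=> i _; rewrite (_ : (fun _ => _) = (fun r : 'rV[R]_k => r ord0 i * r ord0 i)).
    by move=> r; apply: (@cvgM R _ (nbhs r)); exact: coord_continuous.
  by apply/funext => r; rewrite expr2.
move=> r; apply: (@continuous_comp _ _ _ _ Num.sqrt); first exact: sum_cont.
exact: sqrt_continuous.
Qed.

(** Euclidean and cubical balls are exchanged by rescaling along rays from the
    origin. *)
Lemma equi_LC_exact_filling (n : int) S k : uniformly_equi_LC n S ->
  k%:Z <= n -> exact_filling S k.
Proof.
move=> [_ LC] kn eps eps0.
have [d0 d00 hd] := LC (eps / 2) ltac:(lra).
exists (Num.min (eps / 2) (d0 / 4)).
  by rewrite lt_min; apply/andP; split; lra.
move=> A e SA u cu hu.
pose h (r : 'rV[R]_k.+1) := (`|r| / norm2 r) *: r.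
pose h' (r : 'rV[R]_k.+1) := `|r|^-1 *: r.
have n0 (r : 'rV[R]_k.+1) : r != 0 -> norm2 r != 0.
  move=> r0; rewrite gt_eqF //; apply: lt_le_trans (norm2_ge r).
  by rewrite normr_gt0.
have sph0 (r : 'rV[R]_k.+1) : euclidean_sphere r -> r != 0.
  rewrite /euclidean_sphere /= -norm2_sqr => r1; apply/eqP => r0.
  move: r1; rewrite r0 /norm2 big1 ?sqrtr0 ?expr0n => [/eqP|i _].
    by rewrite eq_sym oner_eq0.
  by rewrite mxE expr0n.
have h'1 (r : 'rV[R]_k.+1) : r != 0 -> `|h' r| = 1.
  move=> r0; rewrite normrZ ger0_norm ?invr_ge0 // mulVf //.
  by rewrite normr_eq0.
have sumh (r : 'rV[R]_k.+1) : \sum_i (h r) ord0 i ^+ 2 = `|r| ^+ 2.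
  under eq_bigr do rewrite mxE exprMn.
  rewrite -mulr_sumr -norm2_sqr -exprMn.
  have [->|r0] := eqVneq r 0; first by rewrite normr0 !mul0r.
  by rewrite divfK ?n0.
have uA (r : 'rV[R]_k.+1) : euclidean_sphere r ->
    A (u (h' r)) /\ `|e - u (h' r)| < Num.min (eps / 2) (d0 / 4).
  by move=> /sph0/h'1/hu[].
have [|||v [cv vu vA dv]] := hd A SA k kn (u \o h').
- apply/subspace_continuousP => r r1.
  apply: (@cvg_within_comp _ _ (@euclidean_sphere R k) (@sup_sphere R k)) => //.
    move=> r' /sph0 r'0; apply: cvg_within_filter.
    apply: cvgZ; last exact: cvg_id.
    apply: cvgV; first by rewrite normr_eq0.
    exact: norm_continuous.
  by move=> r' /sph0/h'1.
- by move=> _ [r /uA[]] + _ <-.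
- apply: (@le_lt_trans _ _ (d0 / 2)%:E); last by rewrite lte_fin; lra.
  apply: ge_ereal_sup => _ [[_ _] [[r r1 <-] [r' r'1 <-]] <-] /=.
  rewrite lee_fin; have [_] := uA _ r1; have [_] := uA _ r'1.
  rewrite !lt_min => /andP[_ h1] /andP[_ h2].
  apply: le_trans (ler_distD e _ _) _; rewrite distrC; lra.
exists (v \o h); split.
- apply: (@cvg_within_comp _ _ _ (@euclidean_ball R k)).
  + move=> r _; apply: cvg_within_filter.
    have [->|r0] := eqVneq r 0.
      rewrite {2}/h scaler0; apply/cvgr0Pnorm_lt => x x0.
      apply: filterS (@nbhsx_ballx _ _ (0 : 'rV[R]_k.+1) x x0) => r'.
      rewrite -ball_normE /= sub0r normrN; apply: le_lt_trans.
      rewrite normrZ; apply: ler_piMl => //.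
      rewrite ger0_norm ?divr_ge0 ?sqrtr_ge0 //.
      have [->|r'0] := eqVneq r' 0; first by rewrite normr0 mul0r.
      rewrite ler_pdivrMr ?mul1r ?norm2_ge // lt_neqAle sqrtr_ge0 andbT.
      by rewrite eq_sym n0.
    apply: cvgZ; last exact: cvg_id.
    apply: cvgM; first exact: norm_continuous.
    apply: cvgV; first exact: n0.
    exact: norm2_continuous.
  + move=> r; rewrite /sup_ball /euclidean_ball /= sumh => r1.
    by rewrite expr_le1.
  + by apply/subspace_continuousP.
- move=> r r1 /=; have r0 : r != 0 by rewrite -normr_eq0 r1 oner_eq0.
  rewrite vu; last by rewrite inE /euclidean_sphere /= sumh r1 expr1n.
  rewrite /= /h' /h r1 div1r scalerA; congr (u _).
  rewrite normrZ r1 mulr1 ger0_norm ?invr_ge0 ?sqrtr_ge0 //.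
  by rewrite invrK mulfV ?n0 // scale1r.
- move=> r r1 /=.
  have hr : euclidean_ball (h r) by rewrite /euclidean_ball /= sumh expr_le1.
  split; first by apply: vA; exists (h r).
  pose r1' : 'rV[R]_k.+1 := delta_mx ord0 ord0.
  have s1 : euclidean_sphere r1'.
    rewrite /euclidean_sphere /= (bigD1 ord0) //= big1 => [|i i0].
      by rewrite mxE !eqxx expr1n addr0.
    by rewrite mxE (negbTE i0) andbF expr0n.
  have [_] := uA _ s1; rewrite -[u _]/((u \o h') r1') -vu ?inE //.
  rewrite lt_min => /andP[h1 _].
  have h2 : `|v r1' - v (h r)| < eps / 2.
    rewrite -lte_fin; apply: le_lt_trans dv; apply: ereal_sup_ubound.
    exists (v r1', v (h r)) => //=; split; last by exists (h r).
    exists r1' => //; by rewrite /euclidean_ball /= s1.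
  rewrite /nball /=; apply: le_lt_trans (ler_distD (v r1') _ _) _; lra.
Qed.

(** The analogue of simplicial approximation for maps into [A].  Vertices are
    moved into [A] by choice, and then each cell in turn is filled in [A]; as
    [u] oscillates little on cells, the fillings remain close to [u]. *)
Lemma approx_skeleton S m : (forall k, (k < m)%N -> exact_filling S k) ->
  forall theta, 0 < theta -> exists2 mu, 0 < mu &
  forall A (I : choiceType) (K : set (I -> R)) (u : (I -> R) -> E), S A ->
    (forall s t, face s t -> K t -> K s) ->
    (forall t, K t -> thicken A mu (u t)) ->
    (forall s t, K t -> face s t -> `|u t - u s| < mu) ->
  exists w, forall t, K t -> dim_le t m ->
    [/\ supcont (cell t) w, A (w t) & `|u t - w t| < theta].
Proof.
elim: m => [|m IH] fill theta theta0.
  exists theta => // A I K u SA Kf uA osc.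
  have /choice[w wP] : forall t, exists y, K t -> A y /\ `|u t - y| < theta.
    move=> t; have [/uA[y Ay uy]|nK] := pselect (K t); first by exists y.
    by exists 0.
  exists w => t Kt t0; have [Aw uw] := wP _ Kt; split => //.
  move=> s /(dim_le0_face t0) -> x x0; exists 1 => // s' /(dim_le0_face t0) -> _.
  by rewrite subrr normr0.
have [d d0 hd] := fill m (ltnSn m) (theta / 2) ltac:(lra).
have [|mu0 mu00 hmu] := IH (fun k km => fill k (ltnW km)) (Num.min (d / 2) theta).
  by rewrite lt_min theta0 andbT; lra.
exists (Num.min mu0 (Num.min (theta / 2) (d / 2))).
  by rewrite !lt_min mu00 /=; apply/andP; split; lra.
move=> A I K u SA Kf uA osc.
have [|s t Kt st|w wP] := hmu A I K u SA Kf.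
- by move=> t /uA[y Ay]; rewrite lt_min => /andP[uy _]; exists y.
- by have := osc s t Kt st; rewrite lt_min => /andP[].
pose G t := A `&` nball (u t) theta.
have [||w' [w'w cw' Gw']] := @skeleton_step _ E m I K w G Kf.
- by move=> t Kt tm; have [] := wP t Kt tm.
- move=> t Kt tm ntm; exists (A `&` nball (u t) d), (A `&` nball (u t) (theta / 2)).
  split; first exact: hd.
    move=> s st sm; have [_ Aw uw] := wP s (Kf _ _ st Kt) sm; split => //.
    have := osc s t Kt st; rewrite !lt_min => /and3P[_ _ us].
    move: uw; rewrite lt_min => /andP[uw _]; rewrite /nball /=.
    apply: le_lt_trans (ler_distD (u s) _ _) _; lra.
  move=> s st y [Ay]; rewrite /nball /= => uy; split => //=.
  have := osc s t Kt st; rewrite !lt_min distrC => /and3P[_ us _].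
  rewrite /nball /=; apply: le_lt_trans (ler_distD (u t) _ _) _; lra.
exists w' => t Kt tm1; have cw := cw' t Kt tm1.
have [tm|ntm] := pselect (dim_le t m); last by have [] := Gw' t Kt tm1 ntm.
have [_ Aw] := wP t Kt tm; rewrite lt_min => /andP[_ uw].
by rewrite w'w.
Qed.

End Filling_Properties.

Section Approximate_Filling.
Variables (R : realType) (E : normedModType R).
Implicit Types (S : set (set E)) (A : set E).

Lemma face1_dist (a b : R) : face1 a b -> `|a - b| <= 1.
Proof.
move=> ab; have [bi|nb] := boolP (b \is a Num.int).
  by rewrite (face1_int ab bi) subrr normr0 ler01.
move/(face1_itv _ nb): ab; have := floor_itv b.
rewrite intrD ler_norml; move: (_%:~R) => f; lra.
Qed.

Lemma sup_sphere_compact k : compact (@sup_sphere R k).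
Proof.
apply: bounded_closed_compact.
  exists 1; split; first exact: num_real.
  by move=> x x1 r; rewrite /sup_sphere /= => ->; exact: ltW.
rewrite (_ : @sup_sphere R k = (fun r : 'rV[R]_k.+1 => `|r|) @^-1` [set 1]) //.
by apply: closed_comp => [r _|]; [exact: norm_continuous|exact: closed_eq].
Qed.

Lemma uniform_cont_within (T : normedModType R) (K : set T) (u : T -> E) :
  compact K -> cont_within K u -> forall e, 0 < e -> exists2 d, 0 < d &
  forall r r', K r -> K r' -> `|r - r'| < d -> `|u r - u r'| < e.
Proof.
move=> /compact_near_coveringP cK cu e e0.
pose P d r := K r -> forall r', K r' -> `|r - r'| < d -> `|u r - u r'| < e.
have [d /= d0 hd] : \forall d \near (0 : R)^'+, K `<=` P d.
  apply: cK => r Kr.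
  have e20 : 0 < e / 2 by lra.
  have /cvgrPdist_lt/(_ _ e20) := cu r Kr.
  rewrite near_withinE => /nbhs_ballP[d /= d0 hd].
  exists (ball r (d / 2), [set x | x < d / 2]).
    split => /=; first by apply: nbhsx_ballx; lra.
    by apply: nbhs_right_lt; lra.
  move=> [r1 x] /= [+ xd] Kr1 r2 Kr2 r12; rewrite -ball_normE /= => rr1.
  have h1 : `|u r - u r1| < e / 2.
    by apply: hd => //; rewrite -ball_normE /=; lra.
  have h2 : `|u r - u r2| < e / 2.
    apply: hd => //; rewrite -ball_normE /=.
    apply: le_lt_trans (ler_distD r1 _ _) _; lra.
  apply: le_lt_trans (ler_distD (u r) _ _) _; rewrite distrC; lra.
exists (d / 2); first lra.
move=> r r' Kr Kr' rr'; apply: (hd (d / 2)) => //=; last lra.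
by rewrite sub0r normrN gtr0_norm; lra.
Qed.

(** The sphere is magnified by [N] and cut along the integer grid, which makes the
    oscillation of [u] on cells small.  The filling is the one of the
    approximating sphere [W], shrunk to the ball of radius 1/2, followed by the
    straight-line homotopy from [W] to [u] on the remaining collar. *)
Lemma exact_approx_filling S k : (forall j, (j <= k)%N -> exact_filling S j) ->
  approx_filling S k.
Proof.
move=> fill eps eps0.
have [d' d'0 hd] := fill k (leqnn k) eps eps0.
pose d := Num.min d' eps.
have [dd' de d0] : [/\ d <= d', d <= eps & 0 < d].
  by rewrite !ge_min !lexx orbT lt_min d'0.
exists (d / 2); first lra.
move=> eta eta0; pose theta := Num.min eta (d / 2).
have [te td t0] : [/\ theta <= eta, theta <= d / 2 & 0 < theta].
  by rewrite !ge_min !lexx orbT lt_min eta0; split => //; lra.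
have [mu mu0 hmu] := approx_skeleton (fun j jk => fill j (ltnW jk)) t0.
exists mu => // A e SA u cu hu.
have [rho rho0 hrho] := uniform_cont_within (@sup_sphere_compact k) cu mu0.
have [N N0 Nrho] : exists2 N : nat, (0 < N)%N & N%:R^-1 < rho.
  have [N _ hN] := @near_infty_natSinv_lt R (PosNum rho0).
  by exists N.+1 => //; exact: (hN N (leqnn N)).
have NR0 : 0 < N%:R :> R by rewrite ltr0n.
pose I := 'I_k.+1.
(* The boundary of the cube of side 2N is a union of cells, all of dimension at
   most k. *)
pose K := [set t : I -> R | (forall i, `|t i| <= N%:R) /\ exists i, `|t i| = N%:R].
pose u1 (t : I -> R) := u (\row_j (t j / N%:R)).
have rowK (t : I -> R) : K t -> `|\row_j (t j / N%:R) : 'rV[R]_k.+1| = 1.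
  move=> [tN [i ti]]; apply/eqP; rewrite eq_le; apply/andP; split.
    apply/rV_norm_leP => // j; rewrite mxE normrM [X in _ * X]gtr0_norm ?invr_gt0 //.
    by rewrite ler_pdivrMr // mul1r.
  have : `|(\row_j (t j / N%:R) : 'rV[R]_k.+1) ord0 i| = 1.
    by rewrite mxE normrM ti [X in _ * X]gtr0_norm ?invr_gt0 // mulfV ?gt_eqF.
  by move=> h; apply: le_trans (rV_coord_le _ i); rewrite h.
have Kface s t : face s t -> K t -> K s.
  move=> st [tN [i ti]]; split.
    move=> j; have := tN j; rewrite !ler_norml => /andP[h1 h2].
    have [_ h3] := st j (N%:Z); have [h4 _] := st j (- N%:Z).
    by rewrite h3 // andbT; move: h4; rewrite intrN; apply.
  exists i; suff -> : s i = t i by [].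
  apply: face1_int (st i) _; move: ti => /eqP.
  rewrite eqr_norml => /andP[/orP[]/eqP-> _]; first exact: intr_nat.
  by rewrite rpredN; exact: intr_nat.
have Kdim t : K t -> dim_le t k.
  move=> [_ [i ti]]; exists [fset lift i j | j in 'I_k]%fset; split.
    by rewrite (leq_trans (leq_imfset_card _ _ _)) // size_enum_ord.
  move=> j; case: (unliftP i j) => [j' ->|-> _].
    by rewrite in_imfset.
  move: ti => /eqP.
  rewrite eqr_norml => /andP[/orP[]/eqP-> _]; first exact: intr_nat.
  by rewrite rpredN; exact: intr_nat.
have [||w wP] := hmu A I K u1 SA Kface.
- by move=> t /rowK/hu[].
- move=> s t Kt st; apply: hrho; [exact: rowK|exact: rowK (Kface _ _ st Kt)|].
  apply: le_lt_trans Nrho; apply/rV_norm_leP => [|j]; first by rewrite invr_ge0 ltW.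
  rewrite !mxE -mulrBl normrM [X in _ * X]gtr0_norm ?invr_gt0 // -[leRHS]mul1r.
  by rewrite ler_pM2r ?invr_gt0 // distrC; exact: face1_dist.
pose sc (r : 'rV[R]_k.+1) (i : I) := N%:R * r ord0 i.
have Ksc r : `|r| = 1 -> K (sc r).
  move=> r1; split.
    move=> i; rewrite normrM gtr0_norm // -[leRHS]mulr1 ler_pM2l //.
    by apply: le_trans (rV_coord_le _ i) _; rewrite r1.
  have [i ri] := rV_norm_eq r; exists i.
  by rewrite normrM gtr0_norm // -ri r1 mulr1.
have scK r : \row_j (sc r j / N%:R) = r.
  by apply/rowP => j; rewrite mxE /sc mulrAC mulfV ?gt_eqF // mul1r.
pose W := w \o sc.
have WA r : `|r| = 1 -> A (W r) /\ `|u r - W r| < theta.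
  move=> r1; have [_ Aw uw] := wP _ (Ksc r r1) (Kdim _ (Ksc r r1)).
  by split => //; move: uw; rewrite /u1 scK.
have cW : cont_within (@sup_sphere R k) W.
  move=> r r1; apply: (@glue _ _ _ _ _ sc (sc r) [fset j | j in I]%fset).
  - by near=> r' => i; rewrite !inE.
  - move=> i _; apply: cvg_within_filter.
    apply: cvgM; first exact: cvg_cst.
    exact: coord_continuous.
  - near=> r'; have r'1 : `|r'| = 1 by near: r'; exact: withinT.
    by have [] := wP _ (Ksc _ r'1) (Kdim _ (Ksc _ r'1)).
have [|v [cv vW vA]] := hd A e SA W cW.
  move=> r r1; have [AW uW] := WA r r1; split => //.
  have [_] := hu r r1; rewrite /nball /= => eu.
  apply: le_lt_trans (ler_distD (u r) _ _) _; lra.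
pose nr (r : 'rV[R]_k.+1) := `|r|^-1 *: r.
have nr1 r : r != 0 -> `|nr r| = 1.
  move=> r0; rewrite normrZ ger0_norm ?invr_ge0 // mulVf //.
  by rewrite normr_eq0.
(* [g] doubles the inner ball and collapses the collar to the sphere; [l] grows
   from 0 to 1 across the collar. *)
pose g (r : 'rV[R]_k.+1) := (Num.max 2^-1 `|r|)^-1 *: r.
pose l (r : 'rV[R]_k.+1) := Num.max 0 (2 * `|r| - 1).
pose V r := v (g r) + l r *: (u (nr r) - W (nr r)).
have m0 (r : 'rV[R]_k.+1) : 0 < Num.max 2^-1 `|r|.
  by rewrite lt_max invr_gt0 ltr0n.
have gball r : `|g r| <= 1.
  rewrite normrZ ger0_norm ?invr_ge0 ?(ltW (m0 r)) //.
  by rewrite ler_pdivrMl // mulr1 le_max lexx orbT.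
have max_norm_cont (a : R) : continuous (fun r : 'rV[R]_k.+1 => Num.max a `|r|).
  move=> r; apply: (@continuous_max R _ (cst a) (fun r : 'rV[R]_k.+1 => `|r|)).
    exact: cst_continuous.
  exact: norm_continuous.
have l_cont : continuous l.
  move=> r; apply: (@continuous_max R _ (cst 0) (fun r : 'rV[R]_k.+1 => 2 * `|r| - 1)).
    exact: cst_continuous.
  apply: (@cvgB _ R^o _ (nbhs r)); last exact: cvg_cst.
  by apply: (@cvgM _ _ (nbhs r)); [exact: cvg_cst|exact: norm_continuous].
have nr_comp (z : 'rV[R]_k.+1 -> E) (r : 'rV[R]_k.+1) :
    r != 0 -> cont_within (@sup_sphere R k) z ->
    z (nr r') @[r' --> r] --> z (nr r).
  move=> r0 cz U hU.
  have nr_cont (r1 : 'rV[R]_k.+1) : r1 != 0 ->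
      nr r' @[r' --> within [set r | r != 0] (nbhs r1)] --> nr r1.
    move=> r10; apply: cvg_within_filter; apply: cvgZ; last exact: cvg_id.
    by apply: cvgV; [rewrite normr_eq0|exact: norm_continuous].
  have hw : \forall r' \near r, r' != 0 -> U (z (nr r')).
    exact: (cvg_within_comp nr_cont nr1 cz r0 hU).
  have nz : \forall r' \near r, r' != 0.
    have r0' : 0 < `|r| by rewrite normr_gt0.
    near=> r'; rewrite -normr_gt0; near: r'.
    exact: (cvgr_gt _ (@norm_continuous _ _ r) _ r0').
  change (\forall r' \near r, U (z (nr r'))).
  near=> r'; have : r' != 0 by near: r'; exact: nz.
  by near: r'; exact: hw.
have collar_cont (r : 'rV[R]_k.+1) :
    l r' *: (u (nr r') - W (nr r')) @[r' --> r] --> l r *: (u (nr r) - W (nr r)).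
  have [r2|r2] := ltP `|r| (2^-1).
    have l0 (r' : 'rV[R]_k.+1) : `|r'| < 2^-1 -> l r' = 0.
      by move=> h; apply/max_idPl; lra.
    rewrite (l0 r r2) scale0r; apply/(@cvgrPdist_lt _ _ _ (nbhs r)) => x x0.
    near=> r'; rewrite l0 ?scale0r ?subrr ?normr0 //; near: r'.
    exact: (cvgr_lt _ (@norm_continuous _ _ r) _ r2).
  have r0 : r != 0 by rewrite -normr_gt0; lra.
  apply: (@cvgZ _ _ _ (nbhs r)); first exact: l_cont.
  by apply: (@cvgB _ _ _ (nbhs r)); apply: nr_comp.
exists V; split.
- move=> r r1; apply: (@cvgD _ _ _ (within (@sup_ball R k) (nbhs r))).
    apply: (@cvg_within_comp _ _ _ _ _ (@sup_ball R k) g v) => // [r' _|r' _].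
      apply: cvg_within_filter; apply: cvgZ; last exact: cvg_id.
      by apply: cvgV; [rewrite gt_eqF|exact: max_norm_cont].
    exact: gball.
  exact: cvg_within_filter (collar_cont r).
- move=> r r1; have r0 : r != 0 by rewrite -normr_eq0 r1 oner_eq0.
  have gr : g r = r.
    have mr : Num.max 2^-1 `|r| = `|r| by apply/max_idPr; rewrite r1; lra.
    by rewrite /g mr r1 invr1 scale1r.
  have lr : l r = 1.
    have := r1; rewrite /l => ->; rewrite (_ : 2 * 1 - 1 = 1 :> R); last lra.
    by apply/max_idPr; exact: ler01.
  have nrr : nr r = r by rewrite /nr r1 invr1 scale1r.
  by rewrite /V gr lr nrr vW // scale1r addrC subrK.
- move=> r r1; rewrite /V.
  have [r2|r2] := leP `|r| (2^-1).
    have -> : l r = 0 by apply/max_idPl; lra.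
    rewrite scale0r addr0; have [Av ev] := vA _ (gball r); split => //.
    by exists (v (g r)) => //; rewrite subrr normr0.
  have r0 : r != 0 by rewrite -normr_gt0; lra.
  have -> : v (g r) = W (nr r).
    rewrite -vW ?nr1 //; congr (v (_ *: _)); congr (_^-1).
    by apply/max_idPr; exact: ltW.
  have [AW uW] := WA _ (nr1 _ r0); have [_ eu] := hu _ (nr1 _ r0).
  have [l0 l1] : 0 <= l r /\ l r <= 1.
    by rewrite /l le_max lexx ge_max ler01 /=; split => //; lra.
  split; [exists (W (nr r)) => //|].
    rewrite addrAC subrr add0r normrZ ger0_norm //.
    apply: lt_le_trans te; apply: le_lt_trans uW.
    exact: ler_piMl.
  rewrite /nball /=.
  have -> : e - (W (nr r) + l r *: (u (nr r) - W (nr r))) =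
      (e - u (nr r)) + (1 - l r) *: (u (nr r) - W (nr r)).
    rewrite scalerBl scale1r opprD !addrA; congr (_ - _).
    by rewrite subrK.
  apply: le_lt_trans (ler_normD _ _) _; rewrite normrZ ger0_norm ?subr_ge0 //.
  have : (1 - l r) * `|u (nr r) - W (nr r)| <= `|u (nr r) - W (nr r)|.
    by apply: ler_piMl => //; lra.
  move: eu; rewrite /nball /=; lra.
Unshelve. all: by end_near. Qed.

End Approximate_Filling.

(** * The nerve of a system of bump functions *)

Section Pushforward.
Variables (R : realType) (I : choiceType).
Implicit Types (s t : I -> R) (T : {fset I}).

(** [push t b] is the maximum of the [t a] with [pi a = b], or 0 if there are
    none.  Maxima, as opposed to the sums used for barycentric coordinates,
    preserve the value 1, map cells to cells and do not increase distances. *)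
Definition is_pushforward (pi : I -> I) (push : (I -> R) -> I -> R) : Prop :=
  forall t T, (forall a, 0 <= t a) -> (forall a, a \notin T -> t a = 0) ->
  forall b, [/\ 0 <= push t b, forall a, pi a = b -> t a <= push t b &
    push t b = 0 \/ exists2 a, pi a = b & push t b = t a].

Lemma push_exists (pi : I -> I) : exists push, is_pushforward pi push.
Proof.
have /choice[push pushP] : forall t, exists s, forall T, (forall a, 0 <= t a) ->
    (forall a, a \notin T -> t a = 0) -> forall b,
    [/\ 0 <= s b, forall a, pi a = b -> t a <= s b &
      s b = 0 \/ exists2 a, pi a = b & s b = t a].
  move=> t.
  have [[T [t0 tT]]|no] := pselect (exists T, (forall a, 0 <= t a) /\
      (forall a, a \notin T -> t a = 0)); last first.
    by exists t => T t0 tT; exfalso; apply: no; exists T.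
  exists (fun b => \big[Num.max/0]_(a <- T | pi a == b) t a) => _ _ _ b.
  have m0 : 0 <= \big[Num.max/0]_(a <- T | pi a == b) t a.
    by apply: (@big_ind _ (fun x => 0 <= x)) => // x y x0 _; rewrite le_max x0.
  split => //.
  - move=> a ab; have [aT|/tT -> //] := boolP (a \in T).
    by apply: (le_bigmax_seq 0 a (fun a => pi a == b) t aT); exact/eqP.
  - apply: (@big_ind _ (fun x => x = 0 \/ exists2 a, pi a = b & x = t a)).
    + by left.
    + by move=> x y hx hy; rewrite /Num.max; case: ifP.
    + by move=> a /eqP ab; right; exists a.
by exists push => t T; exact: pushP.
Qed.

Variables (pi : I -> I) (push : (I -> R) -> I -> R).
Hypothesis pushP : is_pushforward pi push.

Variable T : {fset I}.
Definition fin_supp t : Prop :=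
  (forall a, 0 <= t a) /\ (forall a, a \notin T -> t a = 0).

Lemma push_lipschitz s t e : fin_supp s -> fin_supp t -> 0 < e ->
  (forall a, `|s a - t a| < e) -> forall b, `|push s b - push t b| < e.
Proof.
move=> [s0 sT] [t0 tT] e0 st b.
have [ps ls xs] := pushP s0 sT b; have [pt lt xt] := pushP t0 tT b.
rewrite ltr_norml; apply/andP; split.
  case: xt => [->|[a ab ->]]; first by rewrite subr0; apply: lt_le_trans ps; lra.
  by have := st a; have := ls a ab; rewrite ltr_norml; lra.
case: xs => [->|[a ab ->]]; first by rewrite sub0r; apply: le_lt_trans e0; lra.
by have := st a; have := lt a ab; rewrite ltr_norml; lra.
Qed.

Lemma push_face s t : fin_supp s -> fin_supp t -> face s t ->
  face (push s) (push t).
Proof.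
move=> [s0 sT] [t0 tT] st b m.
have [ps ls xs] := pushP s0 sT b; have [pt lt xt] := pushP t0 tT b.
split => h.
  case: xt h => [->|[a ab ->]] h; first exact: le_trans ps.
  by have [h1 _] := st a m; apply: le_trans (ls a ab); exact: h1.
case: xs => [->|[a ab ->]]; first exact: le_trans h.
by have [_ h1] := st a m; apply: h1; exact: le_trans (lt a ab) h.
Qed.

Lemma push_dim t k : fin_supp t -> dim_le t k -> dim_le (push t) k.
Proof.
move=> [t0 tT] [J [Jk hJ]]; exists [fset pi a | a in J]%fset; split.
  by apply: leq_trans Jk; rewrite leq_imfset_card.
move=> b bJ; have [_ _ [->|[a ab ->]]] := pushP t0 tT b; first exact: rpred0.
apply: hJ; apply: contra bJ => aJ; apply/imfsetP; by exists a.
Qed.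

End Pushforward.

Section Nerve.
Variables (R : realType) (X : topologicalType).
Implicit Types (p : X -> X -> R) (t : X -> R).

(** The cells lying over [z]: the cubical form of the simplex of the nerve
    spanned by the indices of the functions that are positive at [z]. *)
Definition star_complex p (z : X) : set (X -> R) :=
  [set t | [/\ forall a, 0 <= t a, forall a, t a <= 1, exists a, t a = 1 &
    forall a, 0 < t a -> 0 < p a z]].

Lemma star_complex_face p z s t : face s t -> star_complex p z t ->
  star_complex p z s.
Proof.
move=> st [t0 t1 [a ta] tp]; split.
- by move=> b; have [h _] := st b 0; apply: h; exact: t0.
- by move=> b; have [_ h] := st b 1; apply: h; exact: t1.
- exists a; suff -> : s a = t a by [].
  by apply: face1_int (st a) _; rewrite ta; exact: rpred1.
- move=> b sb; apply: tp; rewrite lt_neqAle t0 andbT; apply/eqP => tb.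
  have : s b = t b by apply: face1_int (st b) _; rewrite -tb; exact: rpred0.
  by move=> sb'; rewrite sb' -tb ltxx in sb.
Qed.

Lemma bump_support p z : bump_system p -> exists T : {fset X},
  forall a, a \notin T -> p a z = 0.
Proof.
move=> bp; have [N Nz /finite_fsetP[T TE]] := bump_finite bp z.
exists T => a aT; apply/eqP; rewrite eq_le bump_ge0 // andbT leNgt.
apply: contra aT => pa; suff : [set` T] a by [].
by rewrite -TE; exists z; split => //; exact: nbhs_singleton.
Qed.

Lemma star_complex_supp p z T t : (forall a, a \notin T -> p a z = 0) ->
  star_complex p z t -> fin_supp T t.
Proof.
move=> pT [t0 _ _ tp]; split => // a aT; apply/eqP.
rewrite eq_le t0 andbT leNgt; apply/negP => /tp.
by rewrite pT // ltxx.
Qed.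

(** The threshold 1/2 leaves room on both sides: an index whose function is 1 at
    [x] stays usable on a neighbourhood of [x], and an index usable at a nearby
    point is also active at [x]. *)
Lemma bumps_near p x : bump_system p -> \forall z \near x,
  (forall b, p b x = 1 -> 2^-1 < p b z) /\
  (forall b, 2^-1 < p b z -> 0 < p b x).
Proof.
move=> bp; have [N Nx fN] := bump_finite bp x.
pose Q b z := (p b x = 1 -> 2^-1 < p b z) /\ (2^-1 < p b z -> 0 < p b x).
have hQ : \forall z \near x, forall b,
    [set b | [set y | 0 < p b y] `&` N !=set0] b -> Q b z.
  apply: near_finite fN _ => b _.
  have cb : p b z @[z --> x] --> p b x by exact: bump_cont.
  have [pb|pb] := ltP 2^-1 (p b x).
    have h : \forall z \near x, 2^-1 < p b z by exact: cvgr_gt cb _ pb.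
    apply: filterS h => z zb; split => //.
    by move=> _; apply: lt_trans pb; lra.
  have [pb0|pb0] := ltP 0 (p b x).
    near=> z; split => // p1; move: pb; rewrite p1; lra.
  have pb2 : p b x < 2^-1 by apply: le_lt_trans pb0 _; lra.
  have h : \forall z \near x, p b z < 2^-1 by exact: cvgr_lt cb _ pb2.
  apply: filterS h => z zb; split.
    by move=> p1; move: pb; rewrite p1; lra.
  by move=> /(lt_trans zb); rewrite ltxx.
have Nx0 := nbhs_singleton Nx.
apply: filterS2 hQ Nx => z hz Nz; split => b h.
  have : [set b | [set y | 0 < p b y] `&` N !=set0] b.
    by exists x; split; [rewrite /= h ltr01|exact: Nx0].
  by move=> /hz[+ _]; apply.
have : [set b | [set y | 0 < p b y] `&` N !=set0] b.
  by exists z; split => //=; apply: lt_trans h; lra.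
by move=> /hz[_]; apply.
Unshelve. all: by end_near. Qed.

End Nerve.

Section Near_Thicken.
Variables (R : realType) (E : normedModType R).

Lemma sup_ball_compact k : compact (@sup_ball R k).
Proof.
apply: bounded_closed_compact.
  exists 1; split; first exact: num_real.
  by move=> x x1 r; rewrite /sup_ball /= => /le_trans; apply; exact: ltW.
rewrite (_ : @sup_ball R k = (fun r : 'rV[R]_k.+1 => `|r|) @^-1` [set x | x <= 1]) //.
by apply: closed_comp => [r _|]; [exact: norm_continuous|exact: closed_le].
Qed.

Lemma nball_open (e : E) (r : R) : open (nball e r).
Proof.
rewrite (_ : nball e r = (fun y => `|e - y|) @^-1` [set x | x < r]) //.
apply: open_comp => [y _|]; last exact: open_lt.
apply: (@continuous_comp _ _ _ (fun y => e - y)); last exact: norm_continuous.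
by apply: cvgB; [exact: cvg_cst|exact: cvg_id].
Qed.

(** A map of a finite complex into a neighbourhood of [Phi x] is, by compactness
    of the complex and lower semi-continuity, also near [Phi z] for all [z]
    close to [x].  Stability under faces is what makes the complex compact: the
    points near a point outside of it are themselves outside. *)
Lemma near_thicken (X : topologicalType) (Phi : X -> set E) (I : choiceType)
    (T : {fset I}) m (K : set (I -> R)) (v : (I -> R) -> E) (eta : R) (x : X) :
  #|` T| = m.+1 -> lower_semi_continuous Phi ->
  (forall s t, face s t -> K t -> K s) ->
  (forall t, K t -> forall i, 0 <= t i <= 1) ->
  (forall t, K t -> forall i, i \notin T -> t i = 0) ->
  (forall t, K t -> supcont (cell t) v) -> 0 < eta ->
  (forall t, K t -> thicken (Phi x) eta (v t)) ->
  \forall z \near x, forall t, K t -> thicken (Phi z) (3 * eta) (v t).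
Proof.
move=> Tm lsc Kf K01 KT cv eta0 Kv.
have [c [idx [cT cK idxK]]] := fset_coords Tm.
pose phi (r : 'rV[R]_m.+1) i := if i \in T then r ord0 (idx i) else 0.
have const r : \forall r' \near r, forall i, i \notin T -> phi r' i = phi r i.
  by near=> r' => i iT; rewrite /phi (negbTE iT).
have cphi r i : i \in T -> phi r' i @[r' --> r] --> phi r i.
  by move=> iT; rewrite /phi iT; exact: coord_continuous.
pose P z r := K (phi r) -> thicken (Phi z) (3 * eta) (v (phi r)).
have : \forall z \near x, @sup_ball R m `<=` P z.
  apply: ((compact_near_coveringP _).1 (@sup_ball_compact m)) => r0 _.
  have [K0|nK0] := pselect (K (phi r0)); last first.
    have h : \forall r \near r0, face (phi r0) (phi r).
      exact: (@near_face _ _ _ (nbhs r0) phi (phi r0) T _ (const r0) (cphi r0)).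
    exists ([set r | face (phi r0) (phi r)], setT) => /=.
      by split; [|exact: filterT].
    by move=> [r z] /= [h1 _] /(Kf _ _ h1).
  have [y Py vy] := Kv _ K0.
  have h1 : \forall r \near r0, K (phi r) -> `|v (phi r0) - v (phi r)| < eta.
    have : v (phi r) @[r --> within [set r | K (phi r)] (nbhs r0)] --> v (phi r0).
      apply: (@glue _ _ _ _ _ phi (phi r0) T).
      + exact: cvg_within (const r0).
      + by move=> i iT; apply: cvg_within_filter; exact: cphi.
      + by near=> r; apply: cv; near: r; exact: withinT.
    by move=> /cvgrPdist_lt/(_ _ eta0).
  have h2 : \forall z \near x, Phi z `&` nball y eta !=set0.
    apply: open_nbhs_nbhs; split; first by apply: lsc; exact: nball_open.
    by exists y; split => //; rewrite /nball /= subrr normr0.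
  exists ([set r | K (phi r) -> `|v (phi r0) - v (phi r)| < eta],
    [set z | Phi z `&` nball y eta !=set0]) => //=.
  move=> [r z] /= [hr [y' [Py' yy']]] Kr; exists y' => //.
  apply: le_lt_trans (ler_distD (v (phi r0)) _ _) _.
  have := ler_distD y (v (phi r0)) y'; have := hr Kr.
  rewrite [X in X < _ -> _]distrC; move: yy'; rewrite /nball /=; lra.
apply: filterS => z covz t Kt; pose r : 'rV[R]_m.+1 := \row_j t (c j).
have phir : phi r = t.
  apply/funext => i; rewrite /phi; case: ifPn => [iT|iT].
    by rewrite mxE idxK.
  by rewrite (KT t Kt).
rewrite -phir; apply: covz; last by rewrite phir.
apply/rV_norm_leP => // j; rewrite mxE; have /andP[h1 h2] := K01 t Kt (c j).
by rewrite ger0_norm.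
Unshelve. all: by end_near. Qed.
End Near_Thicken.

(** * Improving approximate selections *)

Section Skeletal_Selections.
Variables (R : realType) (E : normedModType R) (S : set (set E)) (d : nat).

Record selection_problem (X : topologicalType) (Phi : X -> set E) (g : X -> E)
    (gamma : R) : Prop := SelectionProblem {
  sp_paracompact : paracompact_space X;
  sp_dim : covering_dim_le X d%:Z;
  sp_mem : forall x, S (Phi x);
  sp_lsc : lower_semi_continuous Phi;
  sp_cont : continuous g;
  sp_approx : approx_selection Phi gamma g }.

Definition skeletal_selection (X : topologicalType) (Phi : X -> set E)
    (g : X -> E) (p : X -> X -> R) (u : (X -> R) -> E) (k : nat)
    (mu eps : R) : Prop :=
  forall z t, star_complex p z t -> dim_le t k ->
    [/\ supcont (cell t) u, thicken (Phi z) mu (u t) & `|u t - g z| < eps].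

(** [gamma] is chosen from [eps] alone, before [mu] and the selection problem. *)
Definition skeletal_solvable (k : nat) : Prop :=
  forall eps, 0 < eps -> exists2 gamma, 0 < gamma &
  forall mu, 0 < mu -> forall X Phi g, @selection_problem X Phi g gamma ->
  exists p u, [/\ bump_system p,
    forall z, family_order_le (fun i => [set y | 0 < p i y]) d%:Z z &
    skeletal_selection Phi g p u k mu eps].

Lemma near_nball (X : topologicalType) (g : X -> E) (x : X) (e : R) :
  continuous g -> 0 < e -> \forall z \near x, `|g x - g z| < e.
Proof. by move=> cg e0; move/cvgrPdist_lt: (cg x) => /(_ _ e0). Qed.

Lemma bumps_subordinate_to_nbhs (X : topologicalType) (N : X -> set X) :
  paracompact_space X -> covering_dim_le X d%:Z ->
  (forall x, \forall z \near x, N x z) ->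
  exists p : X -> X -> R, [/\ bump_system p, forall a z, 0 < p a z -> N a z &
    forall z, family_order_le (fun i => [set y | 0 < p i y]) d%:Z z].
Proof.
move=> par dimX hN.
have [|x|p [bp sp op]] := @subordinate_bumps R X X d%:Z (fun x => (N x)°) par dimX.
- by move=> x; exact: open_interior.
- by exists x; exact: hN.
- exists p; split => // a z /sp; exact: interior_subset.
Qed.

(** By lower semi-continuity, a point of [Phi x] close to [g x] stays close to
    [Phi z] and [g z] for [z] near [x].  Subordinate functions select one such
    point for each vertex. *)
Lemma skeletal_selection0 : skeletal_solvable 0.
Proof.
move=> eps eps0; exists (eps / 2); first lra.
move=> mu mu0 X Phi g [par dimX SPhi lsc cg app].
have /choice[y yP] : forall x, exists y, Phi x y /\ `|g x - y| < eps / 2.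
  by move=> x; have [y] := app x; exists y.
have e20 : 0 < eps / 2 by lra.
have [|p [bp sp op]] := @bumps_subordinate_to_nbhs X (fun x =>
    [set z | Phi z `&` nball (y x) mu !=set0 /\ `|g x - g z| < eps / 2]) par dimX.
  move=> x; apply: filterI; last exact: near_nball.
  apply: open_nbhs_nbhs; split; first by apply: lsc; exact: nball_open.
  by exists (y x); split; [have [] := yP x|rewrite /nball /= subrr normr0].
have /choice[u uP] : forall t : X -> R, exists e, (exists a, t a = 1) ->
    exists2 a, t a = 1 & e = y a.
  move=> t; have [[a ta]|no] := pselect (exists a, t a = 1).
    by exists (y a) => _; exists a.
  by exists 0.
exists p, u; split => // z t [t0 t1 ex1 tp] td.
split.
- move=> s /(dim_le0_face td) -> e e0; exists 1 => // s' /(dim_le0_face td) -> _.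
  by rewrite subrr normr0.
- have [a ta ->] := uP t ex1.
  have [|[y' [Py' yy']] _] := sp a z; first by apply: tp; rewrite ta.
  by exists y'.
- have [a ta ->] := uP t ex1.
  have [|_ gz] := sp a z; first by apply: tp; rewrite ta.
  have [_ gy] := yP a; rewrite distrC in gy.
  apply: le_lt_trans (ler_distD (g a) _ _) _; lra.
Qed.

(** From [p] and [u] on the k-skeleton, first extend [u] over each point [x]
    separately, to [ux x]; then take functions [p'] subordinate to the
    neighbourhoods on which [ux x] still is a good choice.  An index [a] of [p'] is
    sent to some [pi a] with [p (pi a) a = 1], and a cell of the new complex uses
    [ux a0] for one of its vertices [a0], after projection to the old complex.
    On the old k-skeleton all the [ux x] agree with [u], so different choices of
    [a0] are compatible. *)
Lemma skeletal_selectionS k : approx_filling S k ->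
  skeletal_solvable k -> skeletal_solvable k.+1.
Proof.
move=> fill IH eps eps0; have e20 : 0 < eps / 2 by lra.
have [delta delta0 hdelta] := fill _ e20.
have [|gamma gamma0 hgamma] := IH (Num.min delta (eps / 2)).
  by rewrite lt_min delta0.
exists gamma => // mu mu0 X Phi g sel.
have [par dimX SPhi lsc cg _] := sel.
have mu30 : 0 < mu / 3 by lra.
have [muk muk0 hmuk] := hdelta _ mu30.
have [|p [u [bp _ hu]]] := hgamma (Num.min muk (mu / 3)) _ X Phi g sel.
  by rewrite lt_min muk0.
have {}hu z t : star_complex p z t -> dim_le t k ->
    [/\ supcont (cell t) u, thicken (Phi z) muk (u t),
      thicken (Phi z) (mu / 3) (u t), `|u t - g z| < delta &
      `|u t - g z| < eps / 2].
  move=> zt tk; have [cu [y Py uy] gu] := hu z t zt tk.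
  move: uy gu; rewrite !lt_min => /andP[uy uy'] /andP[gu gu'].
  by split => //; exists y.
have /choice[ux uxP] : forall x, exists u', [/\
    forall t, dim_le t k -> u' t = u t,
    forall t, star_complex p x t -> dim_le t k.+1 -> supcont (cell t) u' &
    forall t, star_complex p x t -> dim_le t k.+1 -> ~ dim_le t k ->
      (thicken (Phi x) (mu / 3) `&` nball (g x) (eps / 2)) (u' t)].
  move=> x; apply: (@skeleton_step _ _ k X (star_complex p x) u
    (fun=> thicken (Phi x) (mu / 3) `&` nball (g x) (eps / 2))).
  - by move=> s t; exact: star_complex_face.
  - by move=> t xt tk; have [] := hu x t xt tk.
  - move=> t xt _ _; exists (thicken (Phi x) muk `&` nball (g x) delta),
      (thicken (Phi x) (mu / 3) `&` nball (g x) (eps / 2)); split => //.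
    + exact: hmuk.
    + move=> s st sk; have [_ tk _ gu _] := hu x s (star_complex_face st xt) sk.
      by split => //; rewrite /nball /= distrC.
    + by move=> s _ y.
have near_ux x : \forall z \near x, forall t, star_complex p x t /\ dim_le t k.+1 ->
    thicken (Phi z) mu (ux x t).
  have [T hT] := bump_support x bp.
  have [uxu cux gux] := uxP x.
  have [m Tm] : exists m, #|` (x |` T)%fset| = m.+1.
    exists (#|` (x |` T)%fset|.-1); rewrite prednK // cardfs_gt0.
    by apply/fset0Pn; exists x; rewrite !inE eqxx.
  have -> : mu = 3 * (mu / 3) by lra.
  apply: (@near_thicken R E X Phi X (x |` T)%fset m
    [set t | star_complex p x t /\ dim_le t k.+1]) => //.
  - move=> s t st [xt tk]; split; first exact: star_complex_face xt.
    exact: dim_le_face tk.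
  - by move=> t [[t0 t1 _ _] _] i; rewrite t0 t1.
  - move=> t [xt _] i; rewrite !inE negb_or => /andP[_ iT].
    by have [_] := star_complex_supp hT xt; apply.
  - by move=> t [xt tk]; exact: cux.
  - move=> t [xt tk1]; have [tk|ntk] := pselect (dim_le t k).
      by rewrite uxu //; have [] := hu x t xt tk.
    by have [] := gux t xt tk1 ntk.
have [|p' [bp' sp' op']] := @bumps_subordinate_to_nbhs X (fun x => [set z |
    [/\ forall b, p b x = 1 -> 2^-1 < p b z, forall b, 2^-1 < p b z -> 0 < p b x,
      forall t, star_complex p x t /\ dim_le t k.+1 -> thicken (Phi z) mu (ux x t) &
      `|g x - g z| < eps / 2]]) par dimX.
  move=> x; apply: filterS3 (bumps_near x bp) (near_ux x) (near_nball x cg e20).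
  by move=> z [].
have /choice[pi piP] := bump_eq1 bp.
have [push pushP] := @push_exists R X pi.
have /choice[c cP] : forall C : set X, exists o : option X, C !=set0 ->
    exists2 a, C a & o = Some a.
  move=> C; have [[a Ca]|no] := pselect (C !=set0).
    by exists (Some a) => _; exists a.
  by exists None.
(* The vertex is chosen from the set of coordinates equal to 1, which is the same
   for all points of an open cell. *)
pose u' t := if c [set a | t a = 1] is Some a then ux a (push t) else 0.
(* A cell over z of the new complex is carried by push to a cell of the old
   complex that lies both over z and over every vertex of the new cell. *)
have push_star z t a0 : star_complex p' z t -> 0 < p' a0 z ->
    star_complex p z (push t) /\ star_complex p a0 (push t).
  move=> zt a0z; have [T hT] := bump_support z bp'.
  have [t0 tT] := star_complex_supp hT zt.
  have [_ t1 [a1 ta1] tp] := zt.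
  have key b : 0 < push t b -> 2^-1 < p b z.
    have [_ _ [->|[a <- ->]]] := pushP t T t0 tT b; first by rewrite ltxx.
    by move=> /tp/sp'[h _ _ _]; exact: h.
  suff h x : (forall b, 0 < push t b -> 0 < p b x) -> star_complex p x (push t).
    split; apply: h => b /key pb; first by apply: lt_trans pb; lra.
    by have [_ h _ _] := sp' _ _ a0z; exact: h.
  move=> hx; split => //.
  - by move=> b; have [] := pushP t T t0 tT b.
  - by move=> b; have [_ _ [->//|[a _ ->]]] := pushP t T t0 tT b.
  - exists (pi a1); have [_ h1 h2] := pushP t T t0 tT (pi a1).
    apply/eqP; rewrite eq_le -{2}ta1 h1 // andbT.
    by case: h2 => [->//|[a _ ->]].
exists p', u'; split => // z t zt tk1.
have [T hT] := bump_support z bp'.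
have ft := star_complex_supp hT zt.
have [_ _ ex1 tp] := zt.
have [a0 ta0 ca0] := cP [set a | t a = 1] ex1.
have a0z : 0 < p' a0 z by apply: tp; rewrite ta0.
have [_ _ uxz gz] := sp' _ _ a0z.
have [uxu cux gux] := uxP a0.
have u'E s : face s t -> u' s = ux a0 (push s).
  move=> st; have zs := star_complex_face st zt.
  have fs := star_complex_supp hT zs.
  have [_ _ exs _] := zs.
  have [a1 _ ca1] := cP [set a | s a = 1] exs.
  have [psk|npsk] := pselect (dim_le (push s) k).
    by rewrite /u' ca1 uxu //; have [-> //] := uxP a1.
  have nsk : ~ dim_le s k by move=> sk; apply: npsk; exact: (push_dim pushP fs).
  have ts := face_eq_dim st tk1 nsk.
  rewrite /u' (_ : [set a | s a = 1] = [set a | t a = 1]) ?ca0 //.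
  apply/seteqP; split => a /= sa.
    by rewrite (face1_int (ts a)) // sa; exact: rpred1.
  by rewrite (face1_int (st a)) // sa; exact: rpred1.
have [zpt a0pt] := push_star z t a0 zt a0z.
have ptk1 : dim_le (push t) k.+1 by exact: (push_dim pushP ft).
split.
- apply: (@supcont_eq _ _ _ _ (ux a0 \o push)) => [s st|]; first by rewrite u'E.
  move=> s st e e0.
  have fin r : face r t -> fin_supp T r.
    by move=> rt; exact: star_complex_supp hT (star_complex_face rt zt).
  have ps r : face r t -> face (push r) (push t).
    by move=> rt; exact: (push_face pushP (fin _ rt) ft rt).
  have [e' e'0 he'] := cux _ a0pt ptk1 (push s) (ps s st) e e0.
  exists e' => // r rt sr; apply: he'; first exact: ps.
  exact: (push_lipschitz pushP (fin _ st) (fin _ rt) e'0 sr).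
- by rewrite u'E //; exact: uxz.
- rewrite u'E //; have [ptk|nptk] := pselect (dim_le (push t) k).
    by rewrite uxu //; have [_ _ _ _ h] := hu z _ zpt ptk; lra.
  have [_] := gux _ a0pt ptk1 nptk; rewrite /nball /= distrC => h.
  apply: le_lt_trans (ler_distD (g a0) _ _) _; lra.
Qed.

Lemma approximate_selection : (forall k, (k < d)%N -> approx_filling S k) ->
  forall eps, 0 < eps -> exists2 gamma, 0 < gamma &
  forall mu, 0 < mu -> forall X Phi g, @selection_problem X Phi g gamma ->
  exists f : X -> E, [/\ continuous f, approx_selection Phi mu f &
    forall x, `|f x - g x| < eps].
Proof.
move=> fill eps eps0.
have skel k : (k <= d)%N -> skeletal_solvable k.
  elim: k => [_|k IH kd]; first exact: skeletal_selection0.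
  by apply: skeletal_selectionS; [exact: fill|exact/IH/ltnW].
have [gamma gamma0 hgamma] := skel d (leqnn d) eps eps0.
exists gamma => // mu mu0 X Phi g sel.
have [p [u [bp op hu]]] := hgamma mu mu0 X Phi g sel.
have px x : star_complex p x (p^~ x).
  split => [a|a||a] //=; [exact: bump_ge0|exact: bump_le1|exact: bump_eq1].
have pd x : dim_le (p^~ x) d.
  have [T hT] := bump_support x bp; have [a pa] := bump_eq1 bp x.
  exists ([fset b in T | 0 < p b x] `\ a)%fset; split.
    have h : (#|` [fset b in T | (0 < p b x)%R]%fset|)%:Z <= d%:Z + 1.
      by apply: (op x) => b; rewrite !inE /= => /andP[].
    have := cardfsD1 a [fset b in T | 0 < p b x]%fset.
    have -> : a \in [fset b in T | 0 < p b x]%fset.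
      rewrite !inE /= pa ltr01 andbT; apply: contraT => /hT.
      by rewrite pa => /eqP; rewrite oner_eq0.
    by move=> e; move: h; rewrite e -PoszD lez_nat add1n addn1.
  move=> b; rewrite !inE /= negb_and negbK => /orP[/eqP ->|].
    by rewrite pa; exact: rpred1.
  rewrite negb_and => /orP[/hT ->|]; first exact: rpred0.
  rewrite -leNgt => pb; rewrite (_ : p b x = 0); first exact: rpred0.
  by apply/eqP; rewrite eq_le pb bump_ge0.
exists (fun x => u (p^~ x)); split.
- move=> x; have [N Nx /finite_fsetP[T TN]] := bump_finite bp x.
  have Nx0 := nbhs_singleton Nx.
  apply: (@glue _ _ _ _ (nbhs x) (fun z => p^~ z) (p^~ x) T).
  + have p0 z b : N z -> b \notin T -> p b z = 0.
      move=> Nz bT; apply/eqP; rewrite eq_le bump_ge0 // andbT leNgt.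
      apply: contra bT => pb; suff : [set` T] b by [].
      by rewrite -TN; exists z.
    have h : \forall z \near x, forall b, b \notin T -> p b z = p b x.
      by apply: filterS Nx => z Nz b bT; rewrite !p0.
    exact: h.
  + by move=> b _; exact: bump_cont.
  + by near=> z; have [] := hu z _ (px z) (pd z).
- by move=> x; have [_ h _] := hu x _ (px x) (pd x).
- by move=> x; have [_ _ h] := hu x _ (px x) (pd x).
Unshelve. all: by end_near. Qed.

End Skeletal_Selections.

(** * Passage to the limit *)

Section Uniform_Limits.
Variables (R : realType) (E : completeNormedModType R).

Lemma uniform_cauchy_limit (X : topologicalType) (f : nat -> X -> E)
    (e : nat -> R) :
  (forall i, continuous (f i)) -> e @ \oo --> 0 ->
  (forall i j x, (i <= j)%N -> `|f i x - f j x| <= e i) ->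
  exists F : X -> E, continuous F /\ forall i x, `|f i x - F x| <= e i.
Proof.
move=> cf e0 fe.
have cvgf x : cvg (f i x @[i --> \oo]).
  apply/cauchy_cvgP/cauchy_exP => eps eps0.
  have h : \forall i \near \oo, e i < eps by exact: cvgr_lt e0 _ eps0.
  have [N _ hN] := h; exists (f N x).
  exists N => // j /= Nj; rewrite -ball_normE /=.
  by apply: le_lt_trans (fe N j x Nj) _; apply: hN => /=.
exists (fun x => lim (f i x @[i --> \oo])).
have lim_le i x : `|f i x - lim (f j x @[j --> \oo])| <= e i.
  have h : `|f i x - f j x| @[j --> \oo] --> `|f i x - lim (f j x @[j --> \oo])|.
    by apply: cvg_norm; apply: cvgB; [exact: cvg_cst|exact: cvgf].
  rewrite -(cvg_lim _ h) //; apply: limr_le.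
    by apply/cvg_ex; eexists; exact: h.
  by exists i => // j /= ij; exact: fe.
split => // x; apply/cvgrPdist_lt => eps eps0.
have [N _ hN] : \forall i \near \oo, e i < eps / 3.
  by apply: cvgr_lt e0 _ _; lra.
have eN := hN N (leqnn N).
have eps30 : 0 < eps / 3 by lra.
have /cvgrPdist_lt/(_ _ eps30) := cf N x.
apply: filterS => z hz.
set L := fun x => lim (f j x @[j --> \oo]) in lim_le *.
have h1 := lim_le N x; have h2 := lim_le N z; rewrite distrC in h1.
apply: le_lt_trans (ler_distD (f N x) _ _) _.
have := ler_distD (f N z) (f N x) (L z).
move: hz h1 h2 eN; rewrite /L; lra.
Qed.

End Uniform_Limits.

Theorem theorem5p3 (n : int) (n_ge : -1 <= n) (R : realType)
    (E : completeNormedModType R) (S : set (set E)) :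
  uniformly_equi_LC n S ->
  exists gamma : R -> R,
    (forall eps, 0 < eps -> 0 < gamma eps) /\
    forall (X : topologicalType) (Phi : X -> set E) (eps : R) (g : X -> E),
      paracompact_space X ->
      covering_dim_le X (n + 1) ->
      (forall x, S (Phi x)) ->
      lower_semi_continuous Phi ->
      0 < eps ->
      continuous g ->
      approx_selection Phi (gamma eps) g ->
      exists f : X -> E,
        [/\ continuous f,
            forall x, closure (Phi x) (f x) &
            forall x, `|f x - g x| < eps].
Proof.
move=> LC.
have [d dE] : exists d : nat, n + 1 = d%:Z.
  by exists `|(n + 1)%R|%N; rewrite gez0_abs // -lerBlDr sub0r.
have fill k : (k < d)%N -> approx_filling S k.
  move=> kd; apply: exact_approx_filling => j jk.
  apply: equi_LC_exact_filling LC _.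
  rewrite -(lerD2r 1) dE -PoszD lez_nat addn1.
  exact: leq_ltn_trans jk kd.
have /choice[G GP] : forall eps, exists gamma : R, 0 < eps -> 0 < gamma /\
    forall mu, 0 < mu -> forall X Phi g,
      @selection_problem _ _ S d X Phi g gamma ->
      exists f : X -> E, [/\ continuous f, approx_selection Phi mu f &
        forall x, `|f x - g x| < eps].
  move=> eps; have [eps0|neps] := pselect (0 < eps); last by exists 0.
  by have [gamma gamma0 h] := approximate_selection fill eps0; exists gamma.
exists (fun eps => G (eps / 2)); split.
  by move=> eps eps0; have [] := GP (eps / 2) ltac:(lra).
move=> X Phi eps g par dimX SPhi lsc eps0 cg app.
rewrite dE in dimX.
(* The i-th map is moved by less than [e i]; its accuracy [m i] allows this move
   and, for i > 0, tends to 0. *)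
pose e i : R := eps / (2 ^ i.+1)%:R.
have e_gt0 i : 0 < e i by rewrite divr_gt0 // ltr0n expn_gt0.
have eS i : e i = 2 * e i.+1.
  by rewrite /e (expnS 2 i.+1) natrM invfM; lra.
pose m i := if i is 0%N then G (e 0%N) else Num.min (G (e i)) (e i).
pose good i f := continuous f /\ approx_selection Phi (m i) f.
have /choice[next nextP] : forall q : nat * (X -> E), exists f : X -> E,
    good q.1 q.2 -> good q.1.+1 f /\ forall x, `|f x - q.2 x| < e q.1.
  move=> [i f]; have [[cf af]|ng] := pselect (good i f); last by exists f.
  have [_ h] := GP (e i) (e_gt0 i).
  have [||f' [cf' af' ff']] := h (m i.+1) _ X Phi f; last by exists f'.
    by rewrite lt_min e_gt0 andbT; have [] := GP (e i.+1) (e_gt0 _).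
  split => // x; have [y Py fy] := af x; exists y => //.
  apply: lt_le_trans fy _; case: (i) => [|j] //=.
  by rewrite ge_min lexx.
pose f := fix f i := if i is j.+1 then next (j, f j) else g.
have goodf i : good i (f i).
  elim: i => [|i IH]; last by have [] := nextP (i, f i) IH.
  by split => //; rewrite /= /e expn1.
have fS i x : `|f i.+1 x - f i x| < e i.
  by rewrite distrC; have [_ h] := nextP (i, f i) (goodf i); rewrite distrC; exact: h.
have fe i j x : (i <= j)%N -> `|f i x - f j x| <= 2 * e i - 2 * e j.
  move=> /subnKC <-; elim: (j - i)%N => [|l IH].
    by rewrite addn0 !subrr normr0.
  rewrite addnS; apply: le_trans (ler_distD (f (i + l)%N x) _ _) _.
  have h1 := fS (i + l)%N x; rewrite distrC in h1.
  have := eS (i + l)%N; move: IH h1; lra.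
have e_cvg : (fun i => 2 * e i) @ \oo --> 0.
  have half1 : `|2^-1 : R| < 1 by rewrite ger0_norm ?invr_ge0 // invf_lt1 // ltr1n.
  have := cvg_geometric eps half1; rewrite (_ : geometric _ _ = fun i => 2 * e i) //.
  apply/funext => i; rewrite /geometric /= /e expnS natrM invfM natrX exprVn.
  by move: (_ ^- i) => y; lra.
have [|F [cF FP]] := uniform_cauchy_limit (fun i => (goodf i).1) e_cvg.
  by move=> i j x /fe h; have := e_gt0 j; move: (h x); lra.
exists F; split => //.
- move=> x B /nbhs_ballP[r /= r0 rB].
  have [N _ hN] : \forall i \near \oo, 2 * e i < r by exact: cvgr_lt e_cvg _ r0.
  have [_ /(_ x)[y Py]] := goodf N.+1; rewrite /= lt_min => /andP[_ fy].
  exists y; split => //; apply: rB; rewrite -ball_normE /=.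
  apply: le_lt_trans (ler_distD (f N.+1 x) _ _) _.
  have h1 := FP N.+1 x; rewrite distrC in h1.
  have h2 := hN N (leqnn N); have h3 := eS N; have h4 := e_gt0 N.
  by move: fy h1 h2 h3 h4 => /=; lra.
(* The first move is strictly less than eps/2, all the others together are at
   most eps/2. *)
- move=> x; have h1 := FP 1%N x; rewrite distrC in h1.
  have h2 := fS 0%N x; have h3 := eS 0%N.
  have h4 : e 0%N = eps / 2 by rewrite /e expn1.
  apply: le_lt_trans (ler_distD (f 1%N x) _ _) _.
  by move: h1 h2 h3 h4 => /=; lra.
Qed.
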